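(* Let $D\subset\mathbb{C}^N$ be a (possibly unbounded) convex domain. Then there exist a unique $k$ ($0\le k\le N$) and a unique complete hyperbolic convex domain $D'\subset\mathbb{C}^k$, such that, up to a linear change of coordinates, $D=D'\times\mathbb{C}^{N-k}$.
   Context: A convex domain $D\subset\mathbb{C}^N$ is a domain such that for any $z_0,z_1\in D$ the real segment joining $z_0$ and $z_1$ is contained in $D$. Let $\mathbb{D}=\{\zeta\in\mathbb{C}:|\zeta|<1\}$. For a domain $D\subset\mathbb{C}^N$, $z\in D$ and $v\in\mathbb{C}^N$, the Kobayashi pseudo-metric is $\kappa_D(z;v)=\inf\{\lambda>0:\exists\,\varphi:\mathbb{D}\to D \text{ holomorphic},\ \varphi(0)=z,\ \varphi'(0)=v/\lambda\}$, and the Kobayashi pseudodistance $k_D$ is obtained by integrating $\kappa_D$. The domain $D$ is (Kobayashi) complete hyperbolic if $k_D$ is a complete distance on $D$. For the case $k=0$, $\mathbb{C}^0$ is a point, regarded as a complete hyperbolic convex domain. *)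

(* Defs.v *)
From HB Require Import structures.
From mathcomp Require Import all_boot all_order all_algebra.
From mathcomp Require Import complex.
From mathcomp Require Import all_classical all_reals all_analysis.

Set Implicit Arguments.
Unset Strict Implicit.
Unset Printing Implicit Defensive.

Import Order.TTheory GRing.Theory Num.Theory.
Import numFieldNormedType.Exports.

Local Open Scope classical_set_scope.
Local Open Scope ring_scope.
Local Open Scope complex_scope.

(* MathComp-Analysis puts the topology and norm of the modulus on the concrete
   type [K^o] for every [K : numFieldType]; these instances transfer them to the
   bare type [R[i]], hence also (with the sup norm) to ['rV[R[i]]_N] = C^N. *)
HB.instance Definition _ (R : realType) :=
  GRing.ComAlgebra.copy (complex R) (complex R)^o.
HB.instance Definition _ (R : realType) :=
  Vector.copy (complex R) (complex R)^o.
HB.instance Definition _ (R : realType) :=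
  NormedModule.copy (complex R) (complex R)^o.

Definition domain (R : realType) (N : nat) (D : set 'rV[R[i]]_N) : Prop :=
  [/\ open D, connected D & D !=set0].

Definition convex_domain (R : realType) (N : nat) (D : set 'rV[R[i]]_N) : Prop :=
  domain D /\
  forall z0 z1, D z0 -> D z1 -> forall t : R, 0 <= t <= 1 ->
    D ((1 - t)%:C *: z0 + t%:C *: z1).

(* [derivable phi zeta 1] is complex differentiability at [zeta], since the
   scalar field of both source and target is [R[i]]. *)
Definition holomorphic_disc (R : realType) (N : nat) (D : set 'rV[R[i]]_N)
    (phi : R[i] -> 'rV[R[i]]_N) : Prop :=
  forall zeta : R[i], `|zeta| < 1 -> derivable phi zeta 1 /\ D (phi zeta).

Definition kobayashi_metric (R : realType) (N : nat) (D : set 'rV[R[i]]_N)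
    (z v : 'rV[R[i]]_N) : \bar R :=
  ereal_inf [set lambda%:E | lambda in [set lambda : R | 0 < lambda /\
    exists phi : R[i] -> 'rV[R[i]]_N,
      [/\ holomorphic_disc D phi, phi 0 = z
        & derive1 phi 0 = (lambda^-1)%:C *: v]]].

(* Curves in C^N have a real parameter, whereas ['rV[R[i]]_N] is only a normed
   module over [R[i]]; so they are differentiated through the real and imaginary
   parts of their coordinates. *)
Definition re_coord (R : realType) (N : nat) (gamma : R -> 'rV[R[i]]_N)
  (j : 'I_N) (t : R) : R := complex.Re (gamma t ord0 j).

Definition im_coord (R : realType) (N : nat) (gamma : R -> 'rV[R[i]]_N)
  (j : 'I_N) (t : R) : R := complex.Im (gamma t ord0 j).

Definition curve_derivable (R : realType) (N : nat)
    (gamma : R -> 'rV[R[i]]_N) (t : R) : Prop :=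
  forall j, derivable (re_coord gamma j) t 1 /\ derivable (im_coord gamma j) t 1.

Definition velocity (R : realType) (N : nat)
    (gamma : R -> 'rV[R[i]]_N) (t : R) : 'rV[R[i]]_N :=
  \row_j (derive1 (re_coord gamma j) t +i* derive1 (im_coord gamma j) t).

(* For a curve that is continuous on [a, b], this is being C^1 up to the
   endpoints: the derivative on the open interval extends continuously. *)
Definition C1_piece (R : realType) (N : nat)
    (gamma : R -> 'rV[R[i]]_N) (a b : R) : Prop :=
  exists2 g : R -> 'rV[R[i]]_N, {within `[a, b], continuous g}
    & forall t, a < t < b -> curve_derivable gamma t /\ velocity gamma t = g t.

Definition piecewise_C1 (R : realType) (N : nat)
    (gamma : R -> 'rV[R[i]]_N) : Prop :=
  {within `[0, 1], continuous gamma} /\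
  exists2 s : seq R, itv_partition 0 1 s
    & forall i, (i < size s)%N -> C1_piece gamma (nth 0 (0 :: s) i) (nth 0 s i).

Definition curve_from_to (R : realType) (N : nat) (D : set 'rV[R[i]]_N)
    (z w : 'rV[R[i]]_N) (gamma : R -> 'rV[R[i]]_N) : Prop :=
  [/\ piecewise_C1 gamma, forall t, 0 <= t <= 1 -> D (gamma t),
      gamma 0 = z & gamma 1 = w].

Definition kobayashi_length (R : realType) (N : nat) (D : set 'rV[R[i]]_N)
    (gamma : R -> 'rV[R[i]]_N) : \bar R :=
  (\int[lebesgue_measure]_(t in `[0%R, 1%R])
     kobayashi_metric D (gamma t) (velocity gamma t))%E.

Definition kobayashi_dist (R : realType) (N : nat) (D : set 'rV[R[i]]_N)
    (z w : 'rV[R[i]]_N) : \bar R :=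
  ereal_inf [set kobayashi_length D gamma | gamma in curve_from_to D z w].

(* The pseudodistance [kobayashi_dist D] of a domain [D] is a distance exactly
   when it separates the points of [D]. *)
Definition hyperbolic (R : realType) (N : nat) (D : set 'rV[R[i]]_N) : Prop :=
  forall z w, D z -> D w -> kobayashi_dist D z w = 0%E -> z = w.

Definition kobayashi_cauchy (R : realType) (N : nat) (D : set 'rV[R[i]]_N)
    (u : nat -> 'rV[R[i]]_N) : Prop :=
  forall e : R, 0 < e -> exists n0 : nat, forall m n : nat,
    (n0 <= m)%N -> (n0 <= n)%N -> (kobayashi_dist D (u m) (u n) < e%:E)%E.

Definition complete_hyperbolic (R : realType) (N : nat)
    (D : set 'rV[R[i]]_N) : Prop :=
  hyperbolic D /\
  forall u : nat -> 'rV[R[i]]_N, (forall n, D (u n)) -> kobayashi_cauchy D u ->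
    exists2 w, D w & kobayashi_dist D (u n) w @[n --> \oo] --> 0%E.

(* [D = D' x C^(N-k)] up to the linear change of coordinates [f], where
   C^k x C^(N-k) is the product type; [bijective f] forces [k <= N]. *)
Definition linear_product (R : realType) (N k : nat)
    (D : set 'rV[R[i]]_N) (D' : set 'rV[R[i]]_k) : Prop :=
  exists2 f : {linear 'rV[R[i]]_N -> ('rV[R[i]]_k * 'rV[R[i]]_(N - k))%type},
    bijective f & f @` D = D' `*` setT.

Definition linearly_equivalent (R : realType) (k1 k2 : nat)
    (D1 : set 'rV[R[i]]_k1) (D2 : set 'rV[R[i]]_k2) : Prop :=
  exists2 f : {linear 'rV[R[i]]_k1 -> 'rV[R[i]]_k2},
    bijective f & f @` D1 = D2.

Definition hyperbolic_factor (R : realType) (N k : nat)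
    (D : set 'rV[R[i]]_N) (D' : set 'rV[R[i]]_k) : Prop :=
  [/\ convex_domain D', complete_hyperbolic D' & linear_product D D'].

(* Main.v *)
Require Import Defs.
From HB Require Import structures.
From mathcomp Require Import all_boot all_order all_algebra.
From mathcomp Require Import ring lra.
From mathcomp Require Import complex.
From mathcomp Require Import all_classical all_reals all_analysis.
From mathcomp Require Import measurable_realfun.
Set Implicit Arguments.
Unset Strict Implicit.
Unset Printing Implicit Defensive.
Import Order.TTheory GRing.Theory Num.Theory.
Import numFieldNormedType.Exports.
Local Open Scope classical_set_scope.
Local Open Scope ring_scope.
Local Open Scope complex_scope.
Import Normc.

(* Choose a maximal linearly independent family [a_1, ..., a_k] of complex
   functionals whose real part is bounded above on [D].  By convex separation,
   [D] is a union of fibres of [x |-> (a_1 x, ..., a_k x)], hence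
   [D = D' x C^(N-k)], where every coordinate has real part bounded above
   on [D'].

   If [D] lies in [{Re a < c}], the Schwarz lemma bounds the Kobayashi metric
   of [D] below by a multiple of [|a v| / (c - Re (a z))].  Integrating along
   curves, [ln (c - Re a)] is Lipschitz for the Kobayashi distance and [a] is
   locally Lipschitz.  So a Kobayashi-Cauchy sequence of [D'] converges in
   [C^k], and its limit cannot lie on a supporting hyperplane of [D'].

   Conversely the Kobayashi distance vanishes along complex lines, so the second
   factor is the space of directions of complex lines in [D], which gives
   uniqueness.

   The Schwarz lemma for [f] with [f 0 = 0] follows from Goursat's theorem in
   the logarithmic coordinate: [f (exp w) / exp w dw] is closed, so its period
   over a vertical segment of length [2 pi] does not depend on [Re w], and it
   tends to [2 pi i f'(0)] as [Re w] tends to [-oo]. *)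

(** * Closed 1-forms in the plane and Goursat's theorem *)

Section closed_forms.
Variable R : realType.
Implicit Types (P Q : R -> R -> R).

Lemma increment_le (F f : R -> R) (a b M : R) : a <= b ->
  (forall x, a <= x <= b -> is_derive x 1 F (f x)) ->
  (forall x, a <= x <= b -> `|f x| <= M) ->
  `|F b - F a| <= M * (b - a).
Proof.
move=> ab dF fM.
have [|x|c] := @MVT_segment R F f a b ab.
- by move=> x; rewrite in_itv /= => /andP[/ltW ? /ltW ?]; apply: dF; apply/andP.
- apply: derivable_within_continuous => y; rewrite in_itv /= => /dF[] //.
- rewrite in_itv /= => /fM cM ->.
  by rewrite normrM (ger0_norm (x := b - a)) ?subr_ge0// ler_wpM2r// subr_ge0.
Qed.

Lemma primitive_exists (f : R -> R) (a b : R) : a < b ->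
  (forall x, a <= x <= b -> {for x, continuous f}) ->
  exists F : R -> R, forall x, a < x < b -> is_derive x 1 F (f x).
Proof.
move=> ab cf.
exists (fun x => \int[lebesgue_measure]_(t in [set` `[a, x]]) (f t))%R.
move=> x /andP[ax xb].
have intf : lebesgue_measure.-integrable `[a, b] (EFin \o f).
  apply: continuous_compact_integrable; first exact: segment_compact.
  apply: continuous_in_subspaceT => y; rewrite inE/= in_itv/= => ay; exact: cf.
have xab : a <= x <= b by rewrite !ltW.
have [d e] := continuous_FTC1_closed xb intf ax (cf _ xab).
exact: (DeriveDef d (etrans (esym (derive1E _ _)) e)).
Qed.

(* The real differentiability of a 1-form [P dx + Q dy] at a point where its
   exterior derivative vanishes: [m] is both the y-derivative of [P] and the
   x-derivative of [Q]. *)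
Definition closed_at P Q (x0 y0 : R) := exists p m q : R,
  forall e, 0 < e -> exists2 d, 0 < d & forall x y : R,
    `|x - x0| < d -> `|y - y0| < d ->
    `|P x y - (P x0 y0 + p * (x - x0) + m * (y - y0))|
      <= e * (`|x - x0| + `|y - y0|) /\
    `|Q x y - (Q x0 y0 + m * (x - x0) + q * (y - y0))|
      <= e * (`|x - x0| + `|y - y0|).

Lemma affine_approx_continuous (f : R -> R) (x0 p : R) :
  (forall e, 0 < e -> exists2 d, 0 < d & forall x : R,
    `|x - x0| < d -> `|f x - (f x0 + p * (x - x0))| <= e * `|x - x0|) ->
  {for x0, continuous f}.
Proof.
move=> H; apply/cvgrPdist_le => e e0 /=.
have [d d0 {}H] := H 1 ltr01.
pose d' : R := Num.min d (e / (1 + `|p|)).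
have p0 : 0 < 1 + `|p| by rewrite ltr_pwDl.
have d'0 : 0 < d' by rewrite /d' lt_min d0 divr_gt0.
apply/nbhs_ballP; exists d' => //= x; rewrite /ball /= distrC /d' lt_min => /andP[xd xe].
have := H _ xd; rewrite mul1r distrC => fx.
rewrite -(@ler_pM2l _ (1 + `|p|))//.
have le1 : `|f x0 - f x| <= `|x - x0| + `|p| * `|x - x0|.
  rewrite (_ : f x0 - f x = (f x0 + p * (x - x0) - f x) - p * (x - x0)); last ring.
  by rewrite (le_trans (ler_normB _ _))// normrM lerD2r.
rewrite ler_pM2l// (le_trans le1)//.
by move: xe; rewrite ltr_pdivlMr// => /ltW; rewrite mulrDr mulr1 mulrC.
Qed.

Lemma closed_at_continuous P Q x0 y0 : closed_at P Q x0 y0 ->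
  {for x0, continuous (P^~ y0)} /\ {for y0, continuous (Q x0)}.
Proof.
move=> [p [m [q H]]]; split.
  apply: (@affine_approx_continuous _ _ p) => e /H[d d0 {}H]; exists d => // x xd.
  have [|+ _] := H x y0 xd; first by rewrite subrr normr0.
  by rewrite subrr mulr0 normr0 !addr0.
apply: (@affine_approx_continuous _ _ q) => e /H[d d0 {}H]; exists d => // y yd.
have [|_] := H x0 y _ yd; first by rewrite subrr normr0.
by rewrite subrr mulr0 normr0 add0r addr0.
Qed.

(** Bisection: [Bad n x y] speaks of the rectangle with lower left corner [(x, y)] and sides
    [A / 2 ^+ n], [B / 2 ^+ n]. Badness passes to one of the four quarters, and the suprema of the
    corner coordinates give a point common to the whole chain. *)
Lemma nested_squares (Bad : nat -> R -> R -> Prop) (a b A B : R) :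
  0 <= A -> 0 <= B -> Bad 0%N a b ->
  (forall n x y, Bad n x y -> exists i j : bool,
     Bad n.+1 (x + i%:R * (A / 2 ^+ n.+1)) (y + j%:R * (B / 2 ^+ n.+1))) ->
  exists x0 y0, [/\ a <= x0 <= a + A, b <= y0 <= b + B &
    forall n, exists x y, [/\ Bad n x y, x <= x0 <= x + A / 2 ^+ n,
      y <= y0 <= y + B / 2 ^+ n & (a <= x) && (x + A / 2 ^+ n <= a + A) &&
      ((b <= y) && (y + B / 2 ^+ n <= b + B))]].
Proof.
move=> A0 B0 Bad0 step.
have choose_child (p : nat * R * R) : exists ij : bool * bool,
    Bad p.1.1 p.1.2 p.2 ->
    Bad p.1.1.+1 (p.1.2 + ij.1%:R * (A / 2 ^+ p.1.1.+1))
      (p.2 + ij.2%:R * (B / 2 ^+ p.1.1.+1)).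
  have [/step[i [j ?]]|nB] := pselect (Bad p.1.1 p.1.2 p.2).
    by exists (i, j).
  (* Rectangles that are not bad never occur in the chain, so this choice is arbitrary. *)
  by exists (true, true).
have [c cP] := choice choose_child.
pose nxt p : nat * R * R := (p.1.1.+1, p.1.2 + (c p).1%:R * (A / 2 ^+ p.1.1.+1),
   p.2 + (c p).2%:R * (B / 2 ^+ p.1.1.+1)).
pose s n := iter n nxt (0%N, a, b).
pose x n := (s n).1.2; pose y n := (s n).2.
have s1 n : (s n).1.1 = n by elim: n => //= n ->.
have BadS n : Bad n (x n) (y n).
  elim: n => [//|n IH]; have := cP (s n); rewrite s1 => /(_ IH).
  by rewrite /x /y /= s1.
have half (L : R) n : L / 2 ^+ n = L / 2 ^+ n.+1 + L / 2 ^+ n.+1.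
  by rewrite exprS invfM; field; rewrite expf_neq0.
have Ln0 (L : R) n : 0 <= L -> 0 <= L / 2 ^+ n.
  by move=> ?; rewrite divr_ge0// exprn_ge0.
have limit (L : R) (z : nat -> R) (k : nat -> bool) : 0 <= L ->
    (forall n, z n.+1 = z n + (k n)%:R * (L / 2 ^+ n.+1)) ->
    exists z0, forall n, [/\ z n <= z0 <= z n + L / 2 ^+ n, z 0%N <= z n &
      z n + L / 2 ^+ n <= z 0%N + L].
  move=> L0 zS.
  have zle n : z n <= z n.+1.
    by rewrite zS lerDl mulr_ge0// Ln0.
  have zge n : z n.+1 + L / 2 ^+ n.+1 <= z n + L / 2 ^+ n.
    rewrite zS (half L n) addrA lerD2r lerD2l; case: (k n); rewrite ?mul1r//.
    by rewrite mul0r Ln0.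
  have zm m n : (m <= n)%N -> z m <= z n by move=> mn; apply: (homo_leq lexx le_trans).
  have zm' m n : (m <= n)%N -> z n + L / 2 ^+ n <= z m + L / 2 ^+ m.
    elim: n => [|n IH]; first by rewrite leqn0 => /eqP ->.
    rewrite leq_eqVlt => /predU1P[->//|]; rewrite ltnS => /IH.
    exact: le_trans (zge n).
  have ub n : ubound (range z) (z n + L / 2 ^+ n).
    move=> _ [m _ <-]; have [mn|/ltnW nm] := leqP m n.
      by rewrite (le_trans (zm _ _ mn))// lerDl Ln0.
    by rewrite (le_trans _ (zm' _ _ nm))// lerDl Ln0.
  exists (sup (range z)) => n; split; [apply/andP; split| exact: zm|].
  - apply: sup_upper_bound; last by exists n.
    by split; [exists (z 0%N), 0%N|exists (z 0%N + L / 2 ^+ 0); exact: ub].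
  - by apply: ge_sup (ub n); exists (z 0%N), 0%N.
  - by have := zm' 0%N n (leq0n n); rewrite expr0 divr1.
have [|x0 x0P] := limit A x (fun n => (c (s n)).1) A0; first by move=> n; rewrite /x/= s1.
have [|y0 y0P] := limit B y (fun n => (c (s n)).2) B0; first by move=> n; rewrite /y/= s1.
exists x0, y0; split.
- by have [] := x0P 0%N; rewrite expr0 divr1.
- by have [] := y0P 0%N; rewrite expr0 divr1.
- move=> n; exists (x n), (y n); have [-> -> ->] := x0P n.
  by have [-> -> ->] := y0P n.
Qed.

(** When [H y] is a primitive of [P] along the horizontal at height [y], and [V x] one of [Q] along
    the vertical at [x], this is the counterclockwise integral of [P dx + Q dy] around [[x, x + A] x
    [y, y + B]]. *)
Definition circulation (H V : R -> R -> R) (x y A B : R) : R :=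
  (H y (x + A) - H y x) - (H (y + B) (x + A) - H (y + B) x)
  + ((V (x + A) (y + B) - V (x + A) y) - (V x (y + B) - V x y)).

(** A closed affine form has zero circulation. Only the remainder counts: at most [e * (A + B)]
    along a boundary of length [2 * (A + B)]. *)
Lemma circulation_small P Q (H V : R -> R -> R) (x y A B x0 y0 p m q e : R) :
  0 <= A -> 0 <= B ->
  (forall s t, x <= s <= x + A -> y <= t <= y + B ->
     is_derive s 1 (H t) (P s t) /\ is_derive t 1 (V s) (Q s t)) ->
  x <= x0 <= x + A -> y <= y0 <= y + B ->
  (forall s t, x <= s <= x + A -> y <= t <= y + B ->
    `|P s t - (P x0 y0 + p * (s - x0) + m * (t - y0))| <= e * (A + B) /\
    `|Q s t - (Q x0 y0 + m * (s - x0) + q * (t - y0))| <= e * (A + B)) ->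
  `|circulation H V x y A B| <= 2 * e * (A + B) ^+ 2.
Proof.
move=> A0 B0 dHV xx0 yy0 near.
have xA : x <= x + A by rewrite lerDl.
have yB : y <= y + B by rewrite lerDl.
have xl : x <= x <= x + A by rewrite lexx.
have xr : x <= x + A <= x + A by rewrite lexx andbT.
have yl : y <= y <= y + B by rewrite lexx.
have yr : y <= y + B <= y + B by rewrite lexx andbT.
(* Opposite edges are paired. The terms in [m] remove the affine part of each difference, and their
   total increments [m * B * A] and [- m * A * B] cancel. *)
pose D1 s := H y s - H (y + B) s + m * B * s.
pose D2 t := V (x + A) t - V x t - m * A * t.
have -> : circulation H V x y A B = (D1 (x + A) - D1 x) + (D2 (y + B) - D2 y).
  rewrite /circulation /D1 /D2; ring.
have b1 : `|D1 (x + A) - D1 x| <= (2 * (e * (A + B))) * (x + A - x).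
  apply: (@increment_le _ (fun s => P s y - P s (y + B) + m * B)) => // s sx.
    have [dH1 _] := dHV s y sx yl; have [dH2 _] := dHV s (y + B) sx yr.
    have := is_deriveD (is_deriveB dH1 dH2) (is_deriveZ (m * B) (is_derive_id s 1)).
    by rewrite /GRing.scale/= mulr1.
  have [h1 _] := near s y sx yl; have [h2 _] := near s (y + B) sx yr.
  rewrite [X in `|X|](_ : _ = (P s y - (P x0 y0 + p * (s - x0) + m * (y - y0)))
    - (P s (y + B) - (P x0 y0 + p * (s - x0) + m * (y + B - y0)))); last ring.
  by rewrite (le_trans (ler_normB _ _))// mulrDl mul1r lerD.
have b2 : `|D2 (y + B) - D2 y| <= (2 * (e * (A + B))) * (y + B - y).
  apply: (@increment_le _ (fun t => Q (x + A) t - Q x t - m * A)) => // t ty.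
    have [_ dH1] := dHV (x + A) t xr ty; have [_ dH2] := dHV x t xl ty.
    have := is_deriveB (is_deriveB dH1 dH2) (is_deriveZ (m * A) (is_derive_id t 1)).
    by rewrite /GRing.scale/= mulr1.
  have [_ h1] := near (x + A) t xr ty; have [_ h2] := near x t xl ty.
  rewrite [X in `|X|](_ : _ = (Q (x + A) t - (Q x0 y0 + m * (x + A - x0) + q * (t - y0)))
    - (Q x t - (Q x0 y0 + m * (x - x0) + q * (t - y0)))); last ring.
  by rewrite (le_trans (ler_normB _ _))// mulrDl mul1r lerD.
rewrite (le_trans (ler_normD _ _))// (le_trans (lerD b1 b2))//.
by rewrite le_eqVlt; apply/orP; left; apply/eqP; ring.
Qed.

(* Goursat's subdivision argument: the partial derivatives are not assumed to
   be continuous. *)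
Lemma circulation_eq0 P Q (H V : R -> R -> R) (a b A B : R) :
  0 < A -> 0 < B ->
  (forall s t, a <= s <= a + A -> b <= t <= b + B ->
     [/\ closed_at P Q s t, is_derive s 1 (H t) (P s t)
       & is_derive t 1 (V s) (Q s t)]) ->
  circulation H V a b A B = 0.
Proof.
move=> A0 B0 HV; apply/eqP/negPn/negP => G0.
set eta := `|circulation H V a b A B|.
have eta0 : 0 < eta by rewrite normr_gt0.
(* The circulation is the sum of those of the four quarters, so one quarter keeps at least a fourth
   of it. *)
pose Bad n x y := eta / 4 ^+ n <= `|circulation H V x y (A / 2 ^+ n) (B / 2 ^+ n)|.
have [||||x0 [y0 [x0P y0P sq]]] := @nested_squares Bad a b A B; rewrite ?(ltW A0) ?(ltW B0)//.
- by rewrite /Bad !expr0 !divr1.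
- move=> n x y bad; apply: contrapT => nb.
  have lt (i j : bool) : `|circulation H V (x + i%:R * (A / 2 ^+ n.+1))
      (y + j%:R * (B / 2 ^+ n.+1)) (A / 2 ^+ n.+1) (B / 2 ^+ n.+1)| < eta / 4 ^+ n.+1.
    by rewrite ltNge; apply/negP => h; apply: nb; exists i, j.
  move: bad; apply/negP; rewrite -ltNge.
  have half (L : R) : L / 2 ^+ n = L / 2 ^+ n.+1 + L / 2 ^+ n.+1.
    by rewrite exprS invfM; field; rewrite expf_neq0.
  rewrite (half A) (half B).
  move: (lt false false) (lt false true) (lt true false) (lt true true).
  rewrite !mul0r !mul1r !addr0.
  set A' := A / _; set B' := B / _.
  have -> : eta / 4 ^+ n = eta / 4 ^+ n.+1 *+ 4.
    by rewrite exprS invfM -mulr_natr; field; rewrite expf_neq0.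
  set k := eta / _.
  move=> h1 h2 h3 h4.
  have -> : circulation H V x y (A' + A') (B' + B') =
    circulation H V x y A' B' + circulation H V x (y + B') A' B' +
    circulation H V (x + A') y A' B' + circulation H V (x + A') (y + B') A' B'.
    rewrite /circulation !addrA; ring.
  have -> : k *+ 4 = k + k + k + k by rewrite -mulr_natr; ring.
  do 3![apply: (le_lt_trans (ler_normD _ _)); apply: ltrD => //].
have [[p [m [q cl]]] _ _] := HV _ _ x0P y0P.
have AB : 0 < A + B by rewrite addr_gt0.
(* With this [e], [circulation_small] bounds the circulation of the n-th rectangle by
   [eta / 2 / 4 ^+ n], below the threshold in [Bad]. *)
pose e := eta / (4 * (A + B) ^+ 2).
have e0 : 0 < e by rewrite divr_gt0// mulr_gt0// exprn_gt0.
have [d d0 cld] := cl _ e0.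
have [n nd] : exists n, (A + B) / 2 ^+ n < d.
  have := @cvg_geometric R (A + B) 2^-1.
  rewrite ger0_norm// invf_lt1// ltr1n => /(_ isT) /cvgr0Pnorm_lt /(_ _ d0)[n _ /(_ n (leqnn _))].
  rewrite /geometric /= exprVn ger0_norm; first by exists n.
  by rewrite divr_ge0 ?exprn_ge0 ?ltW.
have [x [y [bad xx0 yy0 /andP[/andP[ax xA] /andP[bY yB]]]]] := sq n.
have An : 0 <= A / 2 ^+ n by rewrite divr_ge0 ?exprn_ge0 ?ltW.
have Bn : 0 <= B / 2 ^+ n by rewrite divr_ge0 ?exprn_ge0 ?ltW.
have := @circulation_small P Q H V x y _ _ x0 y0 p m q e An Bn.
have h1 (s t : R) : x <= s <= x + A / 2 ^+ n -> y <= t <= y + B / 2 ^+ n ->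
  is_derive s 1 (H t) (P s t) /\ is_derive t 1 (V s) (Q s t).
  move=> /andP[s1 s2] /andP[t1 t2]; have [] := HV s t; rewrite ?(le_trans ax)/= ?(le_trans _ xA)//.
  by rewrite (le_trans bY)//= (le_trans _ yB).
move=> /(_ h1 xx0 yy0) {h1}.
have dist (z z0 u L : R) : z <= u <= z + L -> z <= z0 <= z + L -> `|u - z0| <= L.
  by clear=> /andP[? ?] /andP[? ?]; rewrite ler_norml; apply/andP; split; lra.
move: nd; rewrite mulrDl => nd.
have h2 (s t : R) : x <= s <= x + A / 2 ^+ n -> y <= t <= y + B / 2 ^+ n ->
  `|P s t - (P x0 y0 + p * (s - x0) + m * (t - y0))| <= e * (A / 2 ^+ n + B / 2 ^+ n) /\
    `|Q s t - (Q x0 y0 + m * (s - x0) + q * (t - y0))| <= e * (A / 2 ^+ n + B / 2 ^+ n).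
  move=> sx ty; have sx0 := dist _ _ _ _ sx xx0; have ty0 := dist _ _ _ _ ty yy0.
  have [||u v] := cld s t.
  - by rewrite (le_lt_trans sx0)// (le_lt_trans _ nd)// lerDl.
  - by rewrite (le_lt_trans ty0)// (le_lt_trans _ nd)// lerDr.
  have le : e * (`|s - x0| + `|t - y0|) <= e * (A / 2 ^+ n + B / 2 ^+ n).
    by rewrite ler_wpM2l ?lerD// ltW.
  by split; apply: le_trans le.
move=> /(_ h2); apply/negP; rewrite -ltNge; apply: lt_le_trans bad.
rewrite -mulrDl exprMn exprVn -exprM mulnC exprM -(natrX _ 2 2) mulrA ltr_pM2r ?invr_gt0 ?exprn_gt0//.
rewrite /e [X in X < _](_ : _ = eta / 2).
  by rewrite ltr_pdivrMr// mulr_natr mulr2n ltrDl.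
by field; rewrite gt_eqF.
Qed.

(** The circulation around [[s1, s2] x [0, T]] vanishes and the horizontal edges cancel by
    periodicity of [P], which leaves the two vertical periods. *)
Lemma closed_form_period P Q (c T s1 s2 : R) (F1 F2 : R -> R) :
  0 < T -> s1 < s2 -> s2 < c ->
  (forall x y, x < c -> closed_at P Q x y) ->
  (forall x, P x T = P x 0) ->
  (forall y, 0 <= y <= T -> is_derive y 1 F1 (Q s1 y)) ->
  (forall y, 0 <= y <= T -> is_derive y 1 F2 (Q s2 y)) ->
  F1 T - F1 0 = F2 T - F2 0.
Proof.
move=> T0 s12 s2c cl PT dF1 dF2.
(* The horizontal primitives must be differentiable at [s2] itself, hence some room to its right. *)
have [s3 /andP[s23 s3c]] : exists s3, s2 < s3 < c.
  by exists ((s2 + c) / 2); rewrite midf_lt// midf_lt.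
have primx (y : R) : exists F : R -> R, forall x, s1 - 1 < x < s3 -> is_derive x 1 F (P x y).
  apply: primitive_exists; first lra.
  by move=> x /andP[_ xs]; have [] := closed_at_continuous (cl x y _); first exact: le_lt_trans s3c.
have primy (x : R) : exists F : R -> R,
    x < c -> forall y, -1 < y < T + 1 -> is_derive y 1 F (Q x y).
  have [xc|xc] := ltP x c; last by exists idfun.
  have [|y yT|F FP] := @primitive_exists (Q x) (-1) (T + 1); first lra.
    by have [] := closed_at_continuous (cl x y xc).
  by exists F.
have [V0 V0P] := choice primy.
have [H0 H0P] := choice primx.
(* [H T] is made equal to [H 0], which is legitimate as [P x T = P x 0], so that the horizontal
   edges cancel exactly. On the two vertical edges [V] is the given primitive. *)
pose H y := if y == T then H0 0 else H0 y.
pose V x := if x == s1 then F1 else if x == s2 then F2 else V0 x.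
have : circulation H V s1 0 (s2 - s1) T = 0.
  apply: (@circulation_eq0 P Q) => //; first by rewrite subr_gt0.
  rewrite subrKC add0r => s t /andP[s1s ss2] /andP[t0 tT]; split.
  - by apply: cl; exact: le_lt_trans s2c.
  - rewrite /H; case: eqP => [->|_].
      by rewrite PT; apply: H0P; rewrite (le_lt_trans ss2)// andbT; lra.
    by apply: H0P; rewrite (le_lt_trans ss2)// andbT; lra.
  - rewrite /V; case: eqP => [->|_]; first by apply: dF1; rewrite t0.
    case: eqP => [->|_]; first by apply: dF2; rewrite t0.
    by apply: V0P; [exact: le_lt_trans s2c|lra].
rewrite /circulation subrKC add0r /H eqxx lt_eqF// subrr add0r /V eqxx.
by rewrite gt_eqF// eqxx => /eqP; rewrite subr_eq0 => /eqP ->.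
Qed.

End closed_forms.

(** * Complex modulus and exponential *)

Lemma derive_expansion (K : numFieldType) (V : normedModType K) (f : K -> V)
    (x : K) (d : V) : is_derive x 1 f d ->
  forall e : K, 0 < e -> exists2 r, 0 < r &
    forall y, `|y - x| < r -> `|f y - f x - (y - x) *: d| <= e * `|y - x|.
Proof.
move=> [df dE] e e0.
have : h^-1 *: ((f \o shift x) (h *: 1) - f x) @[h --> 0^'] --> d.
  by rewrite -dE; exact: df.
move=> /cvgrPdist_le /(_ _ e0) /nbhs_ballP [r r0 rP].
exists r => // y yx.
have [->|yx0] := eqVneq y x; first by rewrite !subrr scale0r subrr !normr0 mulr0.
have h0 : y - x != 0 by rewrite subr_eq0.
have := rP (y - x); rewrite /ball /= sub0r normrN => /(_ yx h0).
rewrite [_%:A]mulr1 subrK => le.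
have -> : f y - f x - (y - x) *: d = - ((y - x) *: (d - (y - x)^-1 *: (f y - f x))).
  by rewrite scalerBr scalerA divff// scale1r opprB.
by rewrite normrN normrZ mulrC ler_wpM2r.
Qed.

Section complex_modulus.
Variable R : realType.
Implicit Types z w : R[i].

Lemma normE_normc z : `|z| = (normc z)%:C. Proof. by case: z. Qed.

Lemma normc_ge0 z : 0 <= normc z. Proof. by case: z => a b; exact: sqrtr_ge0. Qed.

Lemma ltc_norm z (r : R) : (`|z| < r%:C) = (normc z < r).
Proof. by rewrite normE_normc ltcR. Qed.

Lemma gt0_complex z : 0 < z -> exists2 r : R, 0 < r & z = r%:C.
Proof. by case: z => a b; rewrite ltcE /= => /andP[/eqP -> a0]; exists a. Qed.

Lemma Re_le_normc z : `|complex.Re z| <= normc z.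
Proof. by have := normc_ge_Re z; rewrite normE_normc lecR. Qed.

Lemma Im_le_normc z : `|complex.Im z| <= normc z.
Proof.
by case: z => a b /=; rewrite -sqrtr_sqr ler_sqrt ?addr_ge0 ?sqr_ge0// lerDr sqr_ge0.
Qed.

Lemma normc_le z : normc z <= `|complex.Re z| + `|complex.Im z|.
Proof.
case: z => a b /=; rewrite -[leRHS]ger0_norm ?addr_ge0// -sqrtr_sqr ler_sqrt ?sqr_ge0//.
by rewrite sqrrD !real_normK ?num_real// lerD2r lerDl mulrn_wge0// mulr_ge0.
Qed.

End complex_modulus.

Section complex_exponential.
Variable R : realType.

Definition cexp (w : R[i]) : R[i] :=
  (expR (complex.Re w) * cos (complex.Im w)) +i* (expR (complex.Re w) * sin (complex.Im w)).

Lemma cexpD (z w : R[i]) : cexp (z + w) = cexp z * cexp w.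
Proof.
case: z w => [a b] [c d]; rewrite /cexp /= expRD cosD sinD.
by apply/eqP; rewrite eq_complex /=; apply/andP; split; apply/eqP; ring.
Qed.

Lemma normc_cexp (w : R[i]) : normc (cexp w) = expR (complex.Re w).
Proof.
by rewrite /cexp /= !exprMn -mulrDr cos2Dsin2 mulr1 sqrtr_sqr ger0_norm ?expR_ge0.
Qed.

Lemma cexp_neq0 (w : R[i]) : cexp w != 0.
Proof.
apply/eqP => w0; have := normc_cexp w; rewrite w0 normc0 => /eqP.
by rewrite lt_eqF// expR_gt0.
Qed.

Lemma real_expansion (f : R -> R) (x d : R) : is_derive x 1 f d ->
  forall e, 0 < e -> exists2 r, 0 < r &
    forall y, `|y - x| < r -> `|f y - f x - (y - x) * d| <= e * `|y - x|.
Proof. exact: derive_expansion. Qed.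

Lemma cexp_expansion (e : R) : 0 < e -> exists2 r, 0 < r &
  forall h : R[i], normc h < r -> normc (cexp h - 1 - h) <= e * normc h.
Proof.
move=> e0.
(* The errors of the elementary expansions, each [e / 16], add up to [9 * e / 16] at the end. *)
have e40 : 0 < e / 16 by rewrite divr_gt0.
have [r1 r10 H1] := real_expansion (is_derive_expR 0) e40.
have [r2 r20 H2] := real_expansion (is_derive_cos 0) e40.
have [r3 r30 H3] := real_expansion (is_derive_sin 0) e40.
have [r4 r40 H4] := real_expansion (is_derive_expR 0) ltr01.
pose m : R := Num.min (Num.min r1 r2) (Num.min r3 r4).
exists (Num.min m (Num.min 1 (e / 16))) => [|[x y] hr].
  by rewrite !lt_min r10 r20 r30 r40 ltr01 e40.
move: hr; set n := normc _; rewrite !lt_min => /andP[/andP[/andP[n1 n2] /andP[n3 n4]] /andP[nl1 ne]].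
have n0 : 0 <= n := normc_ge0 _.
have xn : `|x| <= n := Re_le_normc (x +i* y).
have yn : `|y| <= n := Im_le_normc (x +i* y).
have := H1 x; have := H2 y; have := H3 y; have := H4 x.
rewrite !subr0 sin0 cos0 expR0 oppr0 !mulr0 !mulr1 !(subr0, addr0) mul1r.
move=> /(_ (le_lt_trans xn n4)) k4 /(_ (le_lt_trans yn n3)) k3.
move=> /(_ (le_lt_trans yn n2)) k2 /(_ (le_lt_trans xn n1)) k1.
have en : 0 <= e / 16 * n by rewrite mulr_ge0// ltW.
have {}k1 : `|expR x - 1 - x| <= e / 16 * n by rewrite (le_trans k1)// ler_wpM2l// ltW.
have {}k2 : `|cos y - 1| <= e / 16 * n by rewrite (le_trans k2)// ler_wpM2l// ltW.
have {}k3 : `|sin y - y| <= e / 16 * n by rewrite (le_trans k3)// ler_wpM2l// ltW.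
have ex1 : `|expR x - 1| <= 2 * n.
  rewrite (_ : expR x - 1 = (expR x - 1 - x) + x); last ring.
  rewrite (le_trans (ler_normD _ _))// mulrDl mul1r lerD//.
  exact: le_trans k4 _.
have ex3 : `|expR x| <= 3.
  rewrite (_ : expR x = (expR x - 1) + 1); last ring.
  rewrite (le_trans (ler_normD _ _))// normr1.
  by rewrite -[3]/(2 + 1)%:R natrD lerD2r (le_trans ex1)// -[leRHS]mulr1 ler_wpM2l// ltW.
rewrite (le_trans (normc_le _))//= subr0.
have -> : expR x * cos y - 1 - x = (expR x - 1 - x) + expR x * (cos y - 1) by ring.
have -> : expR x * sin y - y = (expR x - 1) * y + expR x * (sin y - y) by ring.
have t1 : `|expR x - 1 - x + expR x * (cos y - 1)| <= e / 16 * n + 3 * (e / 16 * n).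
  by rewrite (le_trans (ler_normD _ _))// lerD// normrM ler_pM.
have t2 : `|(expR x - 1) * y + expR x * (sin y - y)| <= 2 * n * (e / 16) + 3 * (e / 16 * n).
  rewrite (le_trans (ler_normD _ _))// lerD// normrM ler_pM//.
  by rewrite (le_trans yn)// ltW.
by rewrite (le_trans (lerD t1 t2))//; clear -en; lra.
Qed.

Lemma is_derive_cexp (w : R[i]) : is_derive w 1 cexp (cexp w).
Proof.
have H : h^-1 *: ((cexp \o shift w) (h *: 1) - cexp w) @[h --> 0^'] --> cexp w.
  apply/cvgrPdist_le => _ /gt0_complex[e e0 ->].
  have e'0 : 0 < e / (1 + normc (cexp w)).
    by rewrite divr_gt0// ltr_pwDl// normc_ge0.
  have [r r0 H] := cexp_expansion e'0.
  apply/nbhs_ballP; exists r%:C; first by rewrite /= ltcR.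
  move=> h; rewrite /ball /= sub0r normrN ltc_norm => hr h0.
  have -> : cexp w - h^-1 *: (cexp (h%:A + w) - cexp w) =
      - (cexp w * (h^-1 * (cexp h - 1 - h))).
    rewrite [h%:A]mulr1 cexpD /GRing.scale /=; field.
    exact/eqP/eqP.
  rewrite normrN normE_normc lecR !normcM normcV.
  have nh : 0 < normc h.
    rewrite lt_neqAle normc_ge0 andbT eq_sym; apply: contra h0 => /eqP/eq0_normc ->//.
  have le : (normc h)^-1 * normc (cexp h - 1 - h) <= e / (1 + normc (cexp w)).
    by rewrite ler_pdivrMl// mulrC H.
  rewrite (le_trans (ler_wpM2l (normc_ge0 _) le))// mulrCA ler_piMr ?(ltW e0)//.
  by rewrite ler_pdivrMr ?mul1r ?lerDr// ltr_pwDl// normc_ge0.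
by split; [apply/cvg_ex; exists (cexp w)|apply: cvg_lim].
Qed.

End complex_exponential.

(** * The Schwarz lemma *)

Section schwarz.
Variable R : realType.

(** The form is [Im (g dz)]. By the Cauchy-Riemann equations the y-derivative of [Im g] and the
    x-derivative of [Re g] are both [Re d], where [d] is the complex derivative. *)
Lemma holomorphic_closed_at (g : R[i] -> R[i]) (x0 y0 : R) :
  derivable g (x0 +i* y0) 1 ->
  closed_at (fun x y => complex.Im (g (x +i* y)))
            (fun x y => complex.Re (g (x +i* y))) x0 y0.
Proof.
move=> /derivableP; move: ('D_1 g _) => d dg.
exists (complex.Im d), (complex.Re d), (- complex.Im d) => e e0.
have e0' : 0 < e%:C :> R[i] by rewrite ltcR.
have [_ /gt0_complex[r r0 ->] H] := derive_expansion dg e0'.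
exists (r / 2) => [|x y xr yr]; first by rewrite divr_gt0.
pose h : R[i] := (x - x0) +i* (y - y0).
have hE : (x +i* y) - (x0 +i* y0) = h by [].
have hn := normc_le h.
have hr : normc h < r.
  by rewrite (le_lt_trans hn)// (splitr r) ltrD.
have := H (x +i* y); rewrite hE ltc_norm => /(_ hr).
rewrite !normE_normc -rmorphM/= lecR.
set E := _ - _ - _ => nE.
have {}nE : normc E <= e * (`|x - x0| + `|y - y0|).
  by rewrite (le_trans nE)// ler_wpM2l// ltW.
have ImE : complex.Im E = complex.Im (g (x +i* y)) - (complex.Im (g (x0 +i* y0)) +
    complex.Im d * (x - x0) + complex.Re d * (y - y0)).
  rewrite /E; case: (g (x +i* y)) (g (x0 +i* y0)) (d) => [a1 b1] [a2 b2] [a3 b3] /=.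
  ring.
have ReE : complex.Re E = complex.Re (g (x +i* y)) - (complex.Re (g (x0 +i* y0)) +
    complex.Re d * (x - x0) + - complex.Im d * (y - y0)).
  rewrite /E; case: (g (x +i* y)) (g (x0 +i* y0)) (d) => [a1 b1] [a2 b2] [a3 b3] /=.
  ring.
by rewrite -ImE -ReE; split; [have := Im_le_normc E|have := Re_le_normc E];
  move/le_trans; apply.
Qed.

(* The angular mean of [Re (f z / z)] over a circle does not depend on the
   radius: in the coordinate [w = log z] it is the period of a closed form. *)
Lemma schwarz_Re (f : R[i] -> R[i]) (d : R[i]) :
  (forall z, normc z < 1 -> derivable f z 1 /\ normc (f z) <= 1) ->
  f 0 = 0 -> is_derive (0 : R[i]) 1 f d -> `|complex.Re d| <= expR 1.
Proof.
move=> fP f0 df.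
pose g w := f (cexp w) / cexp w.
pose u x y := complex.Re (g (x +i* y)).
pose v x y := complex.Im (g (x +i* y)).
have cexp_lt1 (x y : R) : x < 0 -> normc (cexp (x +i* y)) < 1.
  by move=> x0; rewrite normc_cexp /= expR_lt1.
have cl (x y : R) : x < 0 -> closed_at v u x y.
  move=> x0; apply: holomorphic_closed_at.
  have dE : derivable (@cexp R) (x +i* y) 1 by have [] := is_derive_cexp (x +i* y).
  apply: derivableM; last by apply: derivableV => //; exact: cexp_neq0.
  have [dfE _] := fP _ (cexp_lt1 x y x0).
  have dfcE := differentiable_comp ((derivable1_diffP _ _).1 dE) ((derivable1_diffP _ _).1 dfE).
  exact: ((derivable1_diffP (f \o @cexp R) _).2 dfcE).
pose T : R := pi *+ 2.
have T0 : 0 < T by rewrite /T mulrn_wgt0// pi_gt0.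
have cexpT (x : R) : cexp (x +i* T) = cexp (x +i* 0).
  by rewrite /cexp /= cos2pi sin2pi cos0 sin0.
have prim (x : R) : x < 0 -> exists F : R -> R,
    forall y, 0 <= y <= T -> is_derive y 1 F (u x y).
  move=> x0; have [|y _|F FP] := @primitive_exists R (u x) (-1) (T + 1).
  - by rewrite (lt_trans (y := 0))// ?oppr_lt0// addr_gt0.
  - by have [] := closed_at_continuous (cl x y x0).
  - exists F => y /andP[y0 yT]; apply: FP.
    by rewrite (lt_le_trans _ y0) ?oppr_lt0//= (le_lt_trans yT)// ltrDl.
(* On [Re w = -1] the modulus of [g] is at most [expR 1]: this line is the origin of the
   constant. *)
have [F1 F1P] := prim (-1) (ltrN10 _).
have F1le : `|F1 T - F1 0| <= expR 1 * T.
  rewrite -[in leRHS](subr0 T).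
  apply: (increment_le (ltW T0) F1P) => y _.
  rewrite (le_trans (Re_le_normc _))// /g normcM normcV normc_cexp /= expRN invrK.
  rewrite ler_piMl ?expR_ge0//.
  by have [] := fP _ (cexp_lt1 (-1) y (ltrN10 _)).
rewrite -(ler_pM2r T0); apply/ler_addgt0Pr => e e0.
have eT : 0 < e / T by rewrite divr_gt0.
have eT' : 0 < (e / T)%:C :> R[i] by rewrite ltcR.
have [_ /gt0_complex[r r0 ->] H] := derive_expansion df eT'.
(* The line [Re w = s] is sent to a circle so small that [f z / z] is within [e / T] of [d] on it;
   over a period of length [T] the error is at most [e]. *)
pose s : R := Num.min (-2) (ln r - 1).
have s1 : s < -1 by rewrite /s gt_min ltrN2 ltr1n.
have sr : expR s < r.
  rewrite -ltr_ln ?posrE ?expR_gt0// expRK (@le_lt_trans _ _ (ln r - 1))//.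
    by rewrite /s ge_min lexx orbT.
  by rewrite gtrBl.
have [F2 F2P] := prim s (lt_trans s1 (ltrN10 _)).
have period : F2 T - F2 0 = F1 T - F1 0.
  apply: (@closed_form_period R v u 0 T s (-1) F2 F1 T0 s1 (ltrN10 _) cl) => //.
  by move=> x; rewrite /v /g cexpT.
have : `|(F2 T - complex.Re d * T) - (F2 0 - complex.Re d * 0)| <= (e / T) * (T - 0).
  apply: (@increment_le _ (fun y => F2 y - complex.Re d * y)
    (fun y => u s y - complex.Re d) 0 T _ (ltW T0)) => y yT.
    have := is_deriveB (F2P y yT) (is_deriveZ (complex.Re d) (is_derive_id y 1)).
    by rewrite /GRing.scale/= mulr1.
  rewrite /u /g; set z := s +i* y.
  have nz : normc (cexp z) = expR s by rewrite normc_cexp.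
  have := H (cexp z); rewrite subr0 ltc_norm nz => /(_ sr).
  rewrite f0 subr0 !normE_normc nz -(rmorphM (real_complex R)) lecR.
  have -> : f (cexp z) - cexp z *: d = cexp z * (f (cexp z) / cexp z - d).
    by rewrite mulrBr mulrC mulfVK// cexp_neq0.
  rewrite normcM nz mulrC ler_pM2r ?expR_gt0//; apply: le_trans.
  by have := Re_le_normc (f (cexp z) / cexp z - d); rewrite raddfB.
rewrite subr0 divfK ?gt_eqF// mulr0 subr0 => le.
rewrite -{1}(gtr0_norm T0) -normrM.
have -> : complex.Re d * T = (F1 T - F1 0) - (F2 T - complex.Re d * T - F2 0).
  by rewrite -period; ring.
by rewrite (le_trans (ler_normB _ _))// lerD.
Qed.

(** [schwarz_Re] applied to [f] and to [- 'i * f] bounds both parts of [d], hence the factor 2. *)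
Lemma schwarz (f : R[i] -> R[i]) (d : R[i]) :
  (forall z, normc z < 1 -> derivable f z 1 /\ normc (f z) <= 1) ->
  f 0 = 0 -> is_derive (0 : R[i]) 1 f d -> normc d <= 2 * expR 1.
Proof.
move=> fP f0 df; rewrite (le_trans (normc_le _))// mulrDl mul1r lerD//.
  exact: schwarz_Re df.
have -> : complex.Im d = complex.Re (- 'i * d) by case: d {df} => a b /=; ring.
apply: (@schwarz_Re (fun z => - 'i * f z)); last by rewrite f0 mulr0.
move=> z /fP[dfz fz]; split; first exact: (derivableZ (k := - 'i) dfz).
by rewrite normcM /= !(oppr0, expr0n, add0r, sqrrN, expr1n, sqrtr1, mul1r).
Qed.

(* The Moebius map [(w - p) / (w + conjc p)] sends the right half-plane to the
   disc and [p] to 0. *)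
Lemma half_plane_schwarz (psi : R[i] -> R[i]) (d : R[i]) :
  (forall z, normc z < 1 -> derivable psi z 1 /\ 0 < complex.Re (psi z)) ->
  is_derive (0 : R[i]) 1 psi d ->
  normc d <= 4 * expR 1 * complex.Re (psi 0).
Proof.
move=> psiP dpsi.
have [_ p0] := psiP 0 (eq_ind_r (fun t => t < 1) ltr01 (@normc0 R)).
set p := psi 0 in p0 *.
have den0 (w : R[i]) : 0 < complex.Re w -> w + conjc p != 0.
  move=> w0; apply/eqP => /(congr1 (@complex.Re R)); rewrite raddfD/= => /eqP.
  by rewrite gt_eqF// addr_gt0//; case: (p) p0.
pose den z := psi z + conjc p.
pose f z := (psi z - p) * (den z)^-1.
have f0 : f 0 = 0 by rewrite /f /den subrr mul0r.
have pp : p + conjc p = (2 * complex.Re p)%:C.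
  by case: (p) => a b; apply/eqP; rewrite eq_complex /=; apply/andP; split; apply/eqP; ring.
have dnum z : derivable psi z 1 -> derivable (fun z => psi z - p) z 1.
  move=> h; exact: (derivableB h (derivable_cst p z (1 : R[i]))).
have dden z : derivable psi z 1 -> derivable den z 1.
  move=> h; exact: (derivableD h (derivable_cst (conjc p) z (1 : R[i]))).
have df : is_derive (0 : R[i]) 1 f (d / (2 * complex.Re p)%:C).
  have [dpsi0 _] := dpsi.
  have n0 : den 0 != 0 by exact: den0.
  have h1 : is_derive (0 : R[i]) 1 (fun z => psi z - p) d.
    by have := is_deriveB dpsi (is_derive_cst p (0 : R[i]) (1 : R[i])); rewrite subr0.
  (* In the product rule [D] is multiplied by the numerator, which vanishes at 0, so its value can
     stay unspecified. *)
  have [D h2] : exists D : R[i], is_derive (0 : R[i]) 1 (fun y => (den y)^-1) D.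
    by eexists; exact: (derivableP (@derivableV _ _ den 0 1 n0 (dden _ dpsi0))).
  have e : (psi 0 - p) *: D + (den 0)^-1 *: d = d / (2 * complex.Re p)%:C.
    by rewrite subrr scale0r add0r /den -/p pp [LHS]mulrC.
  rewrite -e.
  exact: (is_deriveM h1 h2).
have fP z : normc z < 1 -> derivable f z 1 /\ normc (f z) <= 1.
  move=> /psiP[dz Rz]; split.
    exact: (derivableM (dnum _ dz) (@derivableV _ _ den z 1 (den0 _ Rz) (dden _ dz))).
  rewrite normcM normcV ler_pdivrMr ?mul1r; last first.
    rewrite lt_neqAle normc_ge0 andbT eq_sym.
    by apply: contra (den0 _ Rz : den z != 0) => /eqP/eq0_normc ->.
  rewrite /den; case: (psi z) (p) Rz p0 => a b [a' b'] /= a0 a'0.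
  rewrite ler_sqrt ?addr_ge0 ?sqr_ge0// lerD2r.
  (* The squared moduli of [w + conjc p] and [w - p] differ by [4 Re w Re p]. *)
  rewrite -subr_ge0 [X in 0 <= X](_ : _ = 4 * (a * a')); last ring.
  by rewrite mulr_ge0// mulr_ge0// ltW.
have := schwarz fP f0 df.
rewrite normcM normcV /= expr0n addr0 sqrtr_sqr gtr0_norm ?mulr_gt0//.
by rewrite ler_pdivrMr ?mulr_gt0// => /le_trans; apply; rewrite mulrACA mulrA -natrM.
Qed.

End schwarz.

(** * Convex separation *)

Section separation.
Variable R : realType.

(* Induction on the dimension.  If the first coordinate takes both signs on [C],
   a functional that supports the slice where it vanishes extends to [C]:
   convexity of [C] bounds the admissible slopes on either side. *)
Lemma convex_supporting_functional (n : nat) (C : set ('I_n -> R)) :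
  C !=set0 ->
  (forall x y, C x -> C y -> forall t : R, 0 <= t <= 1 ->
     C (fun i => (1 - t) * x i + t * y i)) ->
  ~ C (fun=> 0) ->
  exists a : 'I_n -> R, (exists j, a j != 0) /\
    forall x, C x -> 0 <= \sum_j a j * x j.
Proof.
elim: n C => [|n IH] C [x0 Cx0] cC C0.
  by case: C0; rewrite (_ : (fun=> 0) = x0)//; apply/funext => -[].
have [pos|] := pselect (forall x, C x -> 0 <= x ord0).
  exists (fun i => (i == ord0)%:R); split; first by exists ord0; rewrite eqxx oner_eq0.
  move=> x Cx; rewrite big_ord_recl /= mul1r big1 ?addr0 ?pos// => i _.
  by rewrite mul0r.
move=> /existsNP[p /not_implyP[Cp /negP]]; rewrite -ltNge => p0.
have [neg|] := pselect (forall x, C x -> x ord0 <= 0).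
  exists (fun i => - (i == ord0)%:R); split.
    by exists ord0; rewrite eqxx oppr_eq0 oner_eq0.
  move=> x Cx; rewrite big_ord_recl /= mulN1r big1 ?addr0 ?oppr_ge0 ?neg// => i _.
  by rewrite oppr0 mul0r.
move=> /existsNP[q /not_implyP[Cq /negP]]; rewrite -ltNge => q0.
pose ext (y : 'I_n -> R) (i : 'I_n.+1) : R := oapp y 0 (unlift ord0 i).
have ext0 y : ext y ord0 = 0 by rewrite /ext unlift_none.
have extS y j : ext y (lift ord0 j) = y j by rewrite /ext liftK.
have extP x y : x ord0 = 0 -> (forall j, x (lift ord0 j) = y j) -> x = ext y.
  move=> x0E xS; apply/funext => i; case: (unliftP ord0 i) => [j|] ->.
    by rewrite xS extS.
  by rewrite x0E ext0.
pose slice : set ('I_n -> R) := [set y | C (ext y)].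
(* The segment from [x] to [x'] crosses the hyperplane of vanishing first coordinate at the
   parameter [x ord0 / (x ord0 - x' ord0)]. *)
have mix x x' : C x -> C x' -> 0 < x ord0 -> x' ord0 < 0 ->
    slice (fun j => (- x' ord0 * x (lift ord0 j) + x ord0 * x' (lift ord0 j))
                    / (x ord0 - x' ord0)).
  move=> Cx Cx' xp xn.
  have d0 : 0 < x ord0 - x' ord0 by rewrite subr_gt0 (lt_trans xn).
  have t01 : 0 <= x ord0 / (x ord0 - x' ord0) <= 1.
    apply/andP; split; first by rewrite divr_ge0 ?ltW.
    by rewrite ler_pdivrMr// mul1r lerDl oppr_ge0 ltW.
  have := cC x x' Cx Cx' _ t01; rewrite /slice /=; congr C.
  by apply: extP => [|j]; field; rewrite gt_eqF.
have [|y z Sy Sz t t01||b [[j bj] bP]] := IH slice.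
- by eexists; exact: (mix q p).
- have := cC _ _ Sy Sz t t01; rewrite /slice /=; congr C.
  by apply: extP => [|j]; rewrite ?ext0 ?extS// !mulr0 addr0.
- rewrite /slice /= => S0; apply: C0; move: S0; congr C.
  by apply/esym/extP.
pose s x := \sum_j b j * x (lift ord0 j).
have smix x x' : C x -> C x' -> 0 < x ord0 -> x' ord0 < 0 ->
    0 <= - x' ord0 * s x + x ord0 * s x'.
  move=> Cx Cx' xp xn; have := bP _ (mix x x' Cx Cx' xp xn).
  have d0 : 0 < x ord0 - x' ord0 by rewrite subr_gt0 (lt_trans xn).
  rewrite -(pmulr_lge0 _ d0) mulr_suml /s !mulr_sumr -big_split /=.
  by under eq_bigr do rewrite mulrA divfK ?gt_eqF// mulrDr !(mulrCA (b _)).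
(* A slope for the first coordinate works where [x ord0 > 0] if it is above all of [E], and where
   [x' ord0 < 0] if it is below every [s x' / - x' ord0]. By [smix] the supremum of [E] does
   both. *)
pose E := [set - s x / x ord0 | x in [set x | C x /\ 0 < x ord0]].
have Eub x' : C x' -> x' ord0 < 0 -> ubound E (s x' / - x' ord0).
  move=> Cx' xn _ [x [Cx xp] <-].
  rewrite ler_pdivlMr ?oppr_gt0// mulrAC ler_pdivrMr//.
  by rewrite -subr_ge0 (_ : _ - _ = - x' ord0 * s x + x ord0 * s x') ?smix//; ring.
have E0 : E !=set0 by exists (- s q / q ord0); exists q.
have supE : has_sup E by split=> //; exists (s p / - p ord0); exact: Eub.
exists (fun i => oapp b (sup E) (unlift ord0 i)); split.
  by exists (lift ord0 j); rewrite liftK.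
move=> x Cx; rewrite big_ord_recl unlift_none /=.
under eq_bigr do rewrite liftK /=; rewrite -/(s x).
have [xn|xp|x0'] := ltgtP (x ord0) 0.
- have := ge_sup E0 (Eub _ Cx xn).
  by rewrite ler_pdivlMr ?oppr_gt0// mulrN -subr_ge0 opprK addrC.
- have := sup_upper_bound supE; move=> /(_ (- s x / x ord0)).
  by rewrite ler_pdivrMr// -subr_ge0 opprK; apply; exists x.
- rewrite x0' mulr0 add0r; apply: (bP (fun j => x (lift ord0 j))).
  by rewrite /slice /= -(extP x).
Qed.

(** Bilinear, without conjugation, so that [pairing a] is complex linear and every complex
    functional has this form. *)
Definition pairing (N : nat) (a x : 'rV[R[i]]_N) : R[i] := \sum_j x ord0 j * a ord0 j.

Lemma pairingD N (a x y : 'rV[R[i]]_N) : pairing a (x + y) = pairing a x + pairing a y.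
Proof. by rewrite /pairing -big_split; apply: eq_bigr => j _; rewrite mxE mulrDl. Qed.

Lemma pairingZ N (a x : 'rV[R[i]]_N) (c : R[i]) : pairing a (c *: x) = c * pairing a x.
Proof. by rewrite /pairing mulr_sumr; apply: eq_bigr => j _; rewrite mxE mulrA. Qed.

Lemma open_polydisc N (D : set 'rV[R[i]]_N) (x : 'rV[R[i]]_N) : open D -> D x ->
  exists2 r : R, 0 < r & forall y : 'rV[R[i]]_N, (forall j, normc (y ord0 j - x ord0 j) < r) -> D y.
Proof.
rewrite openE => oD /oD /nbhs_ballP[_ /gt0_complex[r r0 ->] rD].
exists r => // y yx; apply: rD; split; [by rewrite /= ltcR|move=> i j].
by rewrite /ball /= distrC ltc_norm ord1.
Qed.

(** A supporting functional of the translate of [D] in [R^(2N)], read as the real part of a complex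
    one, gives a weak inequality. It is strict because [D] is open: a point can be moved inside [D]
    so as to increase the functional. *)
Lemma convex_separation N (D : set 'rV[R[i]]_N) (z : 'rV[R[i]]_N) :
  convex_domain D -> ~ D z ->
  exists a : 'rV[R[i]]_N, forall x, D x ->
    complex.Re (pairing a x) < complex.Re (pairing a z).
Proof.
move=> [[oD _ [x1 Dx1]] cD] Dz.
pose vec (xi : 'I_(N + N) -> R) : 'rV[R[i]]_N :=
  \row_j (xi (lshift N j) +i* xi (rshift N j)).
pose coords (x : 'rV[R[i]]_N) (i : 'I_(N + N)) : R :=
  match fintype.split i with inl j => complex.Re (x ord0 j) | inr j => complex.Im (x ord0 j) end.
have splitl j : fintype.split (lshift N j) = inl j.
  by rewrite -[lshift N j]/(unsplit (inl j)) unsplitK.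
have splitr j : fintype.split (rshift N j) = inr j.
  by rewrite -[rshift N j]/(unsplit (inr j)) unsplitK.
have coordsK x : vec (coords x) = x.
  by apply/rowP => j; rewrite mxE /coords splitl splitr; case: (x ord0 j).
have [|xi eta Cxi Ceta t t01||al [[i ali] alP]] := @convex_supporting_functional
    (N + N) [set xi | D (z + vec xi)].
- by exists (coords (x1 - z)); rewrite /= coordsK subrKC.
- have := cD _ _ Cxi Ceta t t01; rewrite /=; congr D.
  apply/rowP => j; rewrite !mxE; case: (z ord0 j) => u v.
  by apply/eqP; rewrite eq_complex /=; apply/andP; split; apply/eqP; ring.
- by rewrite /= (_ : vec _ = 0) ?addr0//; apply/rowP => j; rewrite !mxE.
(* The signs make [Re (pairing a x)] the opposite of the real functional, which turns a lower bound
   into an upper one. *)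
pose a : 'rV[R[i]]_N := \row_j ((- al (lshift N j)) +i* al (rshift N j)).
have sumE x : \sum_i al i * coords x i = - complex.Re (pairing a x).
  rewrite big_split_ord /= /pairing raddf_sum -sumrN -big_split /=.
  apply: eq_bigr => j _; rewrite /coords splitl splitr mxE.
  by case: (x ord0 j) => u v /=; ring.
have le x : D x -> complex.Re (pairing a x) <= complex.Re (pairing a z).
  move=> Dx; have /alP : [set xi | D (z + vec xi)] (coords (x - z)).
    by rewrite /= coordsK subrKC.
  by rewrite sumE oppr_ge0 pairingD -scaleN1r pairingZ mulN1r raddfB subr_le0.
have [j aj] : exists j, a ord0 j != 0.
  by case: (split_ordP i) ali => j -> alj; exists j; rewrite mxE eq_complex /=;
    rewrite ?oppr_eq0 (negPf alj) ?andbF.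
exists a => x Dx.
have [r r0 rP] := open_polydisc oD Dx.
have n0 : 0 < normc (a ord0 j).
  by rewrite lt_neqAle normc_ge0 andbT eq_sym; apply: contra aj => /eqP/eq0_normc ->.
pose e : R := r / (2 * normc (a ord0 j)).
have e0 : 0 < e by rewrite divr_gt0// mulr_gt0.
(* A multiple of the conjugate of [a ord0 j], so that [c * a ord0 j] is real and positive; its
   modulus [r / 2] keeps the point in the polydisc. *)
pose c : R[i] := e%:C * conjc (a ord0 j).
have nc : normc c = r / 2.
  have nJ (w : R[i]) : normc (conjc w) = normc w by case: w => u v /=; rewrite sqrrN.
  rewrite normcM nJ /e /= expr0n addr0 sqrtr_sqr gtr0_norm// invfM mulrA divfK//.
  by rewrite gt_eqF.
have /le : D (x + c *: delta_mx ord0 j).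
  apply: rP => k; rewrite !mxE eqxx addrAC subrr add0r /=.
  case: (k == j); last by rewrite mulr0 normc0.
  by rewrite mulr1 nc ltr_pdivrMr// ltr_pMr// ltr1n.
rewrite pairingD pairingZ raddfD /=; apply: lt_le_trans; rewrite ltrDl.
have -> : pairing a (delta_mx ord0 j) = a ord0 j.
  rewrite /pairing (bigD1 j)//= mxE !eqxx mul1r big1 ?addr0// => k kj.
  by rewrite mxE (negPf kj) andbF mul0r.
rewrite /c; case: (a ord0 j) aj => u v; rewrite eq_complex negb_and /= => uv.
rewrite [X in 0 < X](_ : _ = e * (u ^+ 2 + v ^+ 2)); last by ring.
rewrite mulr_gt0// lt_neqAle eq_sym addr_ge0 ?sqr_ge0// andbT.
by rewrite paddr_eq0 ?sqr_ge0// !sqrf_eq0 negb_and.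
Qed.
End separation.

(** * Bounds for the Kobayashi metric *)

(* The integral of a nonnegative function is the supremum over the simple
   functions below it, so measurability is irrelevant to monotonicity; this
   spares a proof that the Kobayashi metric is upper semicontinuous. *)
Lemma ge0_le_integral_nonmeasurable d (T : measurableType d) (R : realType)
    (mu : {measure set T -> \bar R}) (D : set T) (f g : T -> \bar R) :
  (forall x, D x -> (0 <= f x)%E) -> (forall x, D x -> (f x <= g x)%E) ->
  (\int[mu]_(x in D) f x <= \int[mu]_(x in D) g x)%E.
Proof.
move=> f0 fg; rewrite !ge0_integralE//; last first.
  by move=> x Dx; rewrite (le_trans (f0 _ Dx))// fg.
apply: le_ereal_sup => _ [h hf <-]; exists h => // x.
rewrite (le_trans (hf x))// /patch; case: ifPn => // /set_mem; exact: fg.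
Qed.

Lemma cvg_rV (K : numFieldType) (T : Type) (F : set_system T) (n : nat)
    (f : T -> 'rV[K]_n) (l : 'rV[K]_n) : Filter F ->
  (forall j, f t ord0 j @[t --> F] --> l ord0 j) -> f @ F --> l.
Proof.
move=> FF fl; apply/cvg_ballP => e e0.
have : \forall t \near F, forall j, ball (l ord0 j) e (f t ord0 j).
  apply: filter_forall => j; exact: (cvg_ballP _ _).1 (fl j) e e0.
by apply: filterS => t H; split => // i j; rewrite ord1.
Qed.

Section kobayashi_metric.
Variable R : realType.

Lemma continuous_pairing N (a : 'rV[R[i]]_N) : continuous (pairing a).
Proof.
apply: (continuous_big (op := +%R)) => [|j _ x]; first exact: add_continuous.
have h1 : {for x, continuous (fun y : 'rV[R[i]]_N => y ord0 j)}.
  exact: (@coord_continuous R[i] 1 N ord0 j x).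
have h2 : {for x, continuous (fun=> a ord0 j : R[i])} by exact: cst_continuous.
exact: (continuousM h1 h2).
Qed.

Lemma is_derive_pairing N (a : 'rV[R[i]]_N) (phi : R[i] -> 'rV[R[i]]_N) (z : R[i]) d :
  is_derive z 1 phi d -> is_derive z 1 (fun z => pairing a (phi z)) (pairing a d).
Proof.
move=> [dphi phid].
have H : h^-1 *: (((fun z => pairing a (phi z)) \o shift z) (h *: 1) - pairing a (phi z))
    @[h --> 0^'] --> pairing a d.
  have := cvg_comp _ _ dphi (continuous_pairing (a := a) (x := 'D_1 phi z)).
  rewrite phid; apply: cvg_trans; apply: near_eq_cvg; near=> h.
  by rewrite /= pairingZ pairingD -scaleN1r pairingZ mulN1r.
by split; [apply/cvg_ex; exists (pairing a d)|exact: cvg_lim].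
Unshelve. all: by end_near. Qed.

Lemma is_derive_affine_disc N (z w : 'rV[R[i]]_N) (t : R[i]) :
  is_derive t 1 (fun t => z + t *: w) w.
Proof.
have H : h^-1 *: (((fun t => z + t *: w) \o shift t) (h *: 1) - (z + t *: w))
    @[h --> 0^'] --> w.
  apply: cvg_near_cst.
  exists 1 => //= h _ h0.
  by rewrite [h%:A]mulr1 scalerDl addrCA addrK scalerA mulVf// scale1r.
by split; [exact: (cvgP w H)|exact: cvg_lim].
Qed.

Lemma kobayashi_metric_ge0 N (D : set 'rV[R[i]]_N) z v : (0 <= kobayashi_metric D z v)%E.
Proof.
by apply: le_ereal_inf_tmp => _ [l [l0 _] <-]; rewrite lee_fin ltW.
Qed.

Lemma kobayashi_metric_le_disc N (D : set 'rV[R[i]]_N) (z v : 'rV[R[i]]_N) (l : R) :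
  0 < l -> (forall t : R[i], normc t < 1 -> D (z + t *: ((l^-1)%:C *: v))) ->
  (kobayashi_metric D z v <= l%:E)%E.
Proof.
move=> l0 zD; apply: ereal_inf_lbound; exists l => //; split=> //.
exists (fun t => z + t *: ((l^-1)%:C *: v)); split.
- move=> t; rewrite normE_normc ltcR => /zD Dt; split=> //.
  by have [] := is_derive_affine_disc z ((l^-1)%:C *: v) t.
- by rewrite scale0r addr0.
- by rewrite derive1E; have [] := is_derive_affine_disc z ((l^-1)%:C *: v) 0.
Qed.

(** A complex line contains affine discs with arbitrarily large derivative. *)
Lemma kobayashi_metric_line N (D : set 'rV[R[i]]_N) (z v : 'rV[R[i]]_N) :
  (forall t : R[i], D (z + t *: v)) -> kobayashi_metric D z v = 0%E.
Proof.
move=> zD; apply/eqP; rewrite eq_le kobayashi_metric_ge0 andbT.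
apply/lee_addgt0Pr => e e0; rewrite add0e; apply: kobayashi_metric_le_disc => // t _.
by rewrite scalerA.
Qed.

Lemma kobayashi_metric_le_polydisc N (D : set 'rV[R[i]]_N) (z v : 'rV[R[i]]_N) (r M : R) :
  0 < r -> 0 <= M -> (forall y : 'rV[R[i]]_N, (forall j, normc (y ord0 j - z ord0 j) < r) -> D y) ->
  (forall j, normc (v ord0 j) <= M) -> (kobayashi_metric D z v <= (M / r)%:E)%E.
Proof.
(* [M] may be 0 while the competitors must be positive, hence the slack [e]. *)
move=> r0 M0 zD vM; apply/lee_addgt0Pr => e e0; rewrite -EFinD.
have Me : 0 < M / r + e by rewrite ltr_wpDl// divr_ge0// ltW.
apply: kobayashi_metric_le_disc => // t t1; apply: zD => j.
rewrite !mxE addrAC subrr add0r !normcM mulrA /= expr0n addr0 sqrtr_sqr.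
rewrite gtr0_norm ?invr_gt0// mulrAC ltr_pdivrMr//.
rewrite (@le_lt_trans _ _ (1 * M))// ?ler_pM ?normc_ge0 ?(ltW t1)//.
by rewrite mul1r mulrDr mulrCA divff ?gt_eqF// mulr1 ltrDl mulr_gt0.
Qed.

(** For a competing disc [phi], [c - pairing a (phi t)] has values in the right half-plane, and
    [half_plane_schwarz] bounds its derivative [- pairing a v / l] at 0. *)
Lemma kobayashi_metric_half_space N (D : set 'rV[R[i]]_N) (a z v : 'rV[R[i]]_N) (c : R) :
  (forall x, D x -> complex.Re (pairing a x) < c) -> D z ->
  ((normc (pairing a v) / (4 * expR 1 * (c - complex.Re (pairing a z))))%:E
     <= kobayashi_metric D z v)%E.
Proof.
move=> Dc Dz; apply: le_ereal_inf_tmp => _ [l [l0 [phi [hol phi0 dphi0]]] <-].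
rewrite lee_fin.
have cz : 0 < c - complex.Re (pairing a z) by rewrite subr_gt0 Dc.
have C0 : 0 < 4 * expR 1 :> R by rewrite mulr_gt0// expR_gt0.
pose psi (t : R[i]) : R[i] := c%:C - pairing a (phi t).
have dphi t : normc t < 1 -> derivable phi t 1 /\ D (phi t).
  by move=> t1; apply: hol; rewrite ltc_norm.
have dpsi (t : R[i]) d : is_derive t (1 : R[i]) phi d -> is_derive t (1 : R[i]) psi (- pairing a d).
  move=> /(is_derive_pairing a) h.
  by have := is_deriveB (is_derive_cst (c%:C : R[i]) (t : R[i]) (1 : R[i])) h; rewrite sub0r.
have psiP t : normc t < 1 -> derivable psi t 1 /\ 0 < complex.Re (psi t).
  move=> /dphi[dt Dt]; split; first by have [] := dpsi _ _ (derivableP dt).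
  by rewrite raddfB /= subr_gt0 Dc.
have [d0 _] := dphi 0 (eq_ind_r (fun t => t < 1) ltr01 (@normc0 R)).
have := half_plane_schwarz psiP (dpsi _ _ (derivableP d0)).
rewrite -derive1E dphi0 pairingZ normcN normcM /= expr0n addr0 sqrtr_sqr.
rewrite gtr0_norm ?invr_gt0// /psi phi0 => h.
by rewrite ler_pdivrMr ?mulr_gt0// -ler_pdivrMl// (le_trans h)// raddfB.
Qed.

End kobayashi_metric.

(** * Increments along curves *)

Section increments.
Variable R : realType.
Notation mu := (@lebesgue_measure R).

(** The fundamental theorem of calculus. [m] lives on the open interval, so that the functions of
    consecutive pieces have disjoint supports. *)
Lemma piece_increment (h g : R -> R) (a c : R) : a < c ->
  {within `[a, c], continuous h} -> {within `[a, c], continuous g} ->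
  (forall t, a < t < c -> is_derive t 1 h (g t)) ->
  let m := (fun t => `|g t|) \_ (`]a, c[%classic) in
  measurable_fun setT m /\
  forall T, a <= T <= c -> (`|h T - h a|%:E <= \int[mu]_x (m x)%:E)%E.
Proof.
move=> ac ch cg dh m.
have mg : measurable_fun `[a, c] g by exact: subspace_continuous_measurable_fun.
have mng : measurable_fun `[a, c] (fun t => `|g t|) by exact: measurableT_comp.
have sub : `]a, c[ `<=` `[a, c] by exact: subset_itv_oo_cc.
have mm : measurable_fun setT m.
  apply/(measurable_restrictT _ _).1 => //.
  exact: (measurable_funS (measurable_itv _) sub mng).
split=> // T /andP[]; rewrite le_eqVlt => /predU1P[<- _|aT Tc].
  by rewrite subrr normr0 integral_ge0// => x _; rewrite lee_fin /m /patch; case: ifP.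
have sT : `[a, T] `<=` `[a, c].
  by apply: subset_itvl; rewrite bnd_simp.
have chT := continuous_subspaceW sT ch.
have cgT := continuous_subspaceW sT cg.
have dhT t : a < t < T -> is_derive t 1 h (g t).
  by move=> /andP[ta tT]; apply: dh; rewrite ta (lt_le_trans tT).
have : (\int[mu]_(x in `[a, T]) (g x)%:E = (h T)%:E - (h a)%:E)%E.
  apply: continuous_FTC2 => //.
    have [_ h1 h2] := (continuous_within_itvP h aT).1 chT.
    by split=> // t; rewrite in_itv /= => /dhT[].
  by move=> t; rewrite in_itv /= => /dhT[_ <-]; rewrite derive1E.
rewrite -EFinB => e.
rewrite -abse_EFin -e.
apply: (le_trans (le_abse_integral _ _ _)) => //.
  by apply/measurable_EFinP; exact: (measurable_funS (measurable_itv _) sT mg).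
have -> : (\int[mu]_x (m x)%:E = \int[mu]_(x in `[a, c]) `|(g x)%:E|)%E.
  rewrite -integral_itv_bndo_bndc; last first.
    apply/measurable_EFinP; apply: (measurable_funS (measurable_itv _) _ mng).
    by apply: subset_itvl; rewrite bnd_simp.
  rewrite -integral_itv_obnd_cbnd; last first.
    by apply/measurable_EFinP; exact: (measurable_funS (measurable_itv _) sub mng).
  rewrite [RHS]integral_mkcond; apply: eq_integral => x _.
  by rewrite /m /patch; case: ifP.
by apply: ge0_subset_integral => //; apply/measurable_EFinP.
Qed.

(** As [k] need not be measurable, its integrals over the pieces cannot simply be added. The
    induction adds measurable minorants instead; their sum [m] is then compared with [k] by
    monotonicity alone. *)
Lemma increment_le_integral (h : R -> R) (k : R -> \bar R) (s : seq R) (a : R) :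
  path <%R a s -> {within `[a, last a s], continuous h} ->
  (forall t, 0 <= k t)%E ->
  (forall i, (i < size s)%N -> exists2 g : R -> R,
     {within `[nth 0 (a :: s) i, nth 0 s i], continuous g} &
     forall t, nth 0 (a :: s) i < t < nth 0 s i ->
       is_derive t 1 h (g t) /\ (`|g t|%:E <= k t)%E) ->
  exists m : R -> R, [/\ measurable_fun setT m,
    forall t, 0 <= m t,
    forall t, ((m t)%:E <= (k \_ `[a, last a s]) t)%E &
    forall T, a <= T <= last a s -> (`|h T - h a|%:E <= \int[mu]_x (m x)%:E)%E].
Proof.
move=> + + k0; elim: s a => [|c s IH] a.
  move=> _ _ _; exists (fun=> 0); split=> //.
  - by move=> t; rewrite /patch; case: ifP.
  - move=> T /=; rewrite -eq_le => /eqP <-.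
    by rewrite subrr normr0 integral_ge0.
rewrite [path _ _ _]/= [last _ _]/= => /andP[ac cs] ch pieces.
have cl : c <= last c s.
  by apply: (itv_partition_le (s := s)); split; rewrite ?eqxx.
have s1 : `[a, c] `<=` `[a, last c s] by apply: subset_itvl; rewrite bnd_simp.
have s2 : `[c, last c s] `<=` `[a, last c s].
  by apply: subset_itvr; rewrite bnd_simp ltW.
have [|m2 [mm2 m20 m2k m2I]] := IH c cs (continuous_subspaceW s2 ch).
  by move=> i; exact: (pieces i.+1).
have [g cg gP] := pieces 0%N isT.
have [mm1 m1I] := piece_increment ac (continuous_subspaceW s1 ch) cg
  (fun t tac => (gP t tac).1).
set m1 := _ \_ _ in mm1 m1I.
have m10 t : 0 <= m1 t by rewrite /m1 /patch; case: ifP.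
have intD : (\int[mu]_x (m1 x + m2 x)%:E =
    \int[mu]_x (m1 x)%:E + \int[mu]_x (m2 x)%:E)%E.
  under eq_integral do rewrite EFinD.
  by rewrite ge0_integralD//; [move=> t _; rewrite lee_fin|exact/measurable_EFinP|
    move=> t _; rewrite lee_fin|exact/measurable_EFinP].
exists (fun t => m1 t + m2 t); split.
- exact: measurable_funD.
- by move=> t; rewrite addr_ge0.
- move=> t; have := m2k t; rewrite /m1 /patch !mem_setE !in_itv /=.
  (* [m1] vanishes from [c] on and [m2] vanishes left of [c], so only one of them counts at each
     point. *)
  have [tc|ct] := ltP t c; rewrite ?andbT ?andbF /=.
    rewrite lee_fin => m2t; have -> : m2 t = 0 by apply/eqP; rewrite eq_le m2t m20.
    have -> : t <= last c s by rewrite (le_trans (ltW tc)).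
    rewrite andbT addr0; have [at_|ta] := ltP a t.
      rewrite (ltW at_); have := gP t; rewrite /= at_ tc => /(_ isT)[_].
      exact.
    by case: ifP => _; [exact: k0|exact: lexx].
  by rewrite (le_trans (ltW ac) ct)/= [point + _]add0r.
- move=> T /andP[aT Tl]; rewrite intD.
  have [Tc|cT] := leP T c.
    have : (`|h T - h a|%:E <= \int[mu]_x (m1 x)%:E)%E by apply: m1I; rewrite aT.
    move=> /le_trans; apply; rewrite leeDl// integral_ge0// => x _.
    by rewrite lee_fin.
  rewrite (_ : h T - h a = (h c - h a) + (h T - h c)); last by ring.
  apply: (@le_trans _ _ (`|h c - h a| + `|h T - h c|)%:E).
    by rewrite lee_fin ler_normD.
  rewrite EFinD leeD//; first by apply: m1I; rewrite lexx ltW.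
  by apply: m2I; rewrite (ltW cT).
Qed.

Lemma increment_le_length (h : R -> R) (k : R -> \bar R) (L : R) :
  {within `[0, 1], continuous h} -> (forall t, 0 <= k t)%E ->
  (exists2 s : seq R, itv_partition 0 1 s & forall i, (i < size s)%N ->
     exists2 g : R -> R,
     {within `[nth 0 (0 :: s) i, nth 0 s i], continuous g} &
     forall t, nth 0 (0 :: s) i < t < nth 0 s i ->
       is_derive t 1 h (g t) /\ (`|g t|%:E <= k t)%E) ->
  (\int[mu]_(t in `[0%R, 1%R]) k t <= L%:E)%E ->
  forall t, 0 <= t <= 1 -> `|h t - h 0| <= L.
Proof.
move=> ch k0 [s [ps /eqP ls] sP] kL t t01.
have ch' : {within `[0, last 0 s], continuous h} by rewrite ls.
have [m [mm m0 mk mI]] := increment_le_integral ps ch' k0 sP.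
rewrite -lee_fin; apply: le_trans kL.
have : (`|h t - h 0|%:E <= \int[mu]_x (m x)%:E)%E by apply: mI; rewrite ls.
move=> /le_trans; apply; rewrite [leRHS]integral_mkcond.
apply: ge0_le_integral_nonmeasurable => x _; first by rewrite lee_fin.
by have := mk x; rewrite ls.
Qed.

End increments.

(** * Variation of a bounded functional along a curve of given Kobayashi length *)

Section curves.
Variables (R : realType) (N : nat).
Implicit Types (D : set 'rV[R[i]]_N) (gamma : R -> 'rV[R[i]]_N) (a : 'rV[R[i]]_N).

Lemma continuous_Re : continuous (@complex.Re R : R[i] -> R).
Proof.
move=> z A /(nbhs_ballP (complex.Re z)) [e e0 eA]; apply/(nbhs_ballP z).
exists e%:C; first by rewrite /= ltcR.
move=> w; rewrite /ball /= ltc_norm => zw; apply: eA.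
by rewrite /ball /= -raddfB (le_lt_trans (Re_le_normc _)).
Qed.

Lemma continuous_Re_pairing a : continuous (fun x => complex.Re (pairing a x)).
Proof.
by move=> x; apply: continuous_comp; [exact: continuous_pairing|exact: continuous_Re].
Qed.

Lemma is_derive_Re_pairing gamma (t : R) a : curve_derivable gamma t ->
  is_derive t 1 (fun t => complex.Re (pairing a (gamma t)))
    (complex.Re (pairing a (velocity gamma t))).
Proof.
move=> dg.
have E x : complex.Re (pairing a x) = \sum_j (complex.Re (a ord0 j) * complex.Re (x ord0 j)
    - complex.Im (a ord0 j) * complex.Im (x ord0 j)).
  rewrite /pairing raddf_sum; apply: eq_bigr => j _.
  by case: (x ord0 j) (a ord0 j) => x1 x2 [a1 a2] /=; ring.
have -> : (fun t => complex.Re (pairing a (gamma t))) =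
    \sum_j (complex.Re (a ord0 j) \*: re_coord gamma j
            - complex.Im (a ord0 j) \*: im_coord gamma j).
  by apply/funext => u; rewrite fct_sumE E.
rewrite E; apply: is_derive_sum => j; rewrite !mxE /= !derive1E.
have [dr di] := dg j.
exact: (is_deriveB (is_deriveZ _ (derivableP dr)) (is_deriveZ _ (derivableP di))).
Qed.

Lemma itv_partition_piece (s : seq R) (i : nat) : itv_partition 0 1 s -> (i < size s)%N ->
  0 <= nth 0 (0 :: s) i /\ nth 0 s i <= 1.
Proof.
move=> ps si; split.
  rewrite (set_nth_default 1)/= ?ltnS 1?ltnW//.
  by apply: (itv_partition_nth_ge _ ps); rewrite ltnS ltnW.
by rewrite (set_nth_default 1)//; apply: (itv_partition_nth_le (m := i.+1) _ ps).
Qed.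

Section functional.
Variables (D : set 'rV[R[i]]_N) (a z w : 'rV[R[i]]_N) (c L : R) (gamma : R -> 'rV[R[i]]_N).
Hypothesis Dc : forall x, D x -> complex.Re (pairing a x) < c.
Hypothesis zw : curve_from_to D z w gamma.
Hypothesis lenL : (kobayashi_length D gamma <= L%:E)%E.
Let ell x : R := c - complex.Re (pairing a x).
Let C : R := 4 * expR 1.

Let C0 : 0 < C. Proof. by rewrite mulr_gt0// expR_gt0. Qed.

Let ell_gt0 t : 0 <= t <= 1 -> 0 < ell (gamma t).
Proof. by have [_ Dg _ _] := zw => t01; rewrite subr_gt0; exact/Dc/Dg. Qed.

(** By [kobayashi_metric_half_space], the metric along [gamma] dominates the derivative of
    [C^-1 * ln (ell (gamma u))]. *)
Lemma kobayashi_length_ln (t : R) : 0 <= t <= 1 ->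
  `|ln (ell (gamma t)) - ln (ell z)| <= C * L.
Proof.
have [[cg [s ps sP]] Dg g0 g1] := zw => t01.
pose h u : R := C^-1 * ln (ell (gamma u)).
have cell u (A : set R) : A `<=` `[0, 1] -> A u -> forall b,
    complex.Re (pairing b (gamma x)) @[x --> within A (nbhs u)] --> complex.Re (pairing b (gamma u)).
  move=> A01 Au b; have /subspace_continuousP/(_ u Au) cgu := continuous_subspaceW A01 cg.
  exact: (@cvg_comp _ _ _ gamma (fun x => complex.Re (pairing b x)) _ _ _ cgu
    (@continuous_Re_pairing b (gamma u))).
have le : `|h t - h 0| <= L.
  apply: (@increment_le_length R h
    (fun u => kobayashi_metric D (gamma u) (velocity gamma u))) => //.
  - apply/subspace_continuousP => u u01.
    have u01' : 0 <= u <= 1 by move: u01; rewrite /= in_itv.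
    have ce : ell (gamma x) @[x --> within `[0, 1] (nbhs u)] --> ell (gamma u).
      by apply: cvgB; [exact: cvg_cst|exact: cell].
    have cl := @cvg_comp _ _ _ (fun x => ell (gamma x)) (@ln R) _ _ _ ce
      (continuous_ln (ell_gt0 u01')).
    by apply: cvgM; [exact: cvg_cst|exact: cl].
  - by move=> u; exact: kobayashi_metric_ge0.
  exists s => // i si; have [g cgi gP] := sP i si.
  have [s0 s1] := itv_partition_piece ps si.
  exists (fun u => C^-1 * ((ell (gamma u))^-1 * - complex.Re (pairing a (g u)))).
    apply/subspace_continuousP => u ui.
    have sub : `[(nth 0 (0 :: s) i), (nth 0 s i)] `<=` `[0, 1].
      by apply: subset_itv; rewrite bnd_simp.
    have u01 : 0 <= u <= 1 by have := sub _ ui; rewrite /= in_itv.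
    apply: cvgM; first exact: cvg_cst.
    apply: cvgM.
      apply: cvgV; first by rewrite gt_eqF// ell_gt0.
      by apply: cvgB; [exact: cvg_cst|exact: cell].
    apply: cvgN; have /subspace_continuousP/(_ u ui) cgu := cgi.
    exact: (@cvg_comp _ _ _ g (fun x => complex.Re (pairing a x)) _ _ _ cgu
      (@continuous_Re_pairing a (g u))).
  move=> u /andP[su us].
  have u01 : 0 <= u <= 1 by rewrite (le_trans s0 (ltW su)) (le_trans (ltW us) s1).
  have [dg gu] := gP u (introT andP (conj su us)).
  have e0 := ell_gt0 u01.
  have dRe := is_derive_Re_pairing a dg.
  have dell : is_derive u 1 (fun u => ell (gamma u)) (- complex.Re (pairing a (g u))).
    by rewrite -gu; have := is_deriveB (is_derive_cst c u 1) dRe; rewrite sub0r.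
  split; first exact: (is_deriveZ C^-1
    (@is_derive1_comp R (@ln R) (fun u => ell (gamma u)) u _ _ (is_derive1_ln e0) dell)).
  have := kobayashi_metric_half_space (velocity gamma u) Dc (Dg u u01).
  apply: le_trans; rewrite lee_fin gu !normrM normrN !normfV.
  rewrite (gtr0_norm C0) (gtr0_norm e0) mulrA -invfM mulrC ler_pM2r ?invr_gt0 ?mulr_gt0//.
  exact: Re_le_normc.
move: le; rewrite /h g0 -mulrBr normrM normfV (gtr0_norm C0).
by rewrite ler_pdivrMl.
Qed.

Lemma kobayashi_length_ell (t : R) : 0 <= t <= 1 ->
  ell z * expR (- (C * L)) <= ell (gamma t) <= ell z * expR (C * L).
Proof.
move=> t01; have := kobayashi_length_ln t01.
have ez : 0 < ell z by have [_ _ <- _] := zw; apply: ell_gt0; rewrite lexx ler01.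
have elz : expR (ln (ell z)) = ell z by rewrite lnK.
have elt : expR (ln (ell (gamma t))) = ell (gamma t) by rewrite lnK// posrE ell_gt0.
rewrite ler_distl => /andP[lo hi].
by apply/andP; split; rewrite -elz -elt -expRD ler_expR.
Qed.

(** By [kobayashi_length_ell], [M] bounds [C * ell] along the curve, so the metric dominates [M^-1]
    times the derivative of [Re (pairing b (gamma u))]. Taking [b] to be [a] or [- 'i *: a] yields
    the real and the imaginary part of [pairing a]. *)
Lemma kobayashi_length_Re (b : 'rV[R[i]]_N) :
  (forall v, normc (pairing b v) = normc (pairing a v)) ->
  `|complex.Re (pairing b w) - complex.Re (pairing b z)|
    <= C * (ell z * expR (C * L)) * L.
Proof.
move=> ba; have [[cg [s ps sP]] Dg g0 g1] := zw.
have ez : 0 < ell z by rewrite -g0; apply: ell_gt0; rewrite lexx ler01.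
set M : R := C * (ell z * expR (C * L)).
have M0 : 0 < M by rewrite mulr_gt0// mulr_gt0// expR_gt0.
pose h u : R := M^-1 * complex.Re (pairing b (gamma u)).
have : `|h 1 - h 0| <= L.
  apply: (@increment_le_length R h
    (fun u => kobayashi_metric D (gamma u) (velocity gamma u))) => //.
  - apply/subspace_continuousP => u u01.
    apply: cvgM; first exact: cvg_cst.
    have /subspace_continuousP/(_ u u01) cgu := cg.
    exact: (@cvg_comp _ _ _ gamma (fun x => complex.Re (pairing b x)) _ _ _ cgu
    (@continuous_Re_pairing b (gamma u))).
  - by move=> u; exact: kobayashi_metric_ge0.
  - exists s => // i si; have [g cgi gP] := sP i si.
    have [s0 s1] := itv_partition_piece ps si.
    exists (fun u => M^-1 * complex.Re (pairing b (g u))).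
      apply/subspace_continuousP => u ui.
      apply: cvgM; first exact: cvg_cst.
      have /subspace_continuousP/(_ u ui) cgu := cgi.
      exact: (@cvg_comp _ _ _ g (fun x => complex.Re (pairing b x)) _ _ _ cgu
        (@continuous_Re_pairing b (g u))).
    move=> u /andP[su us].
    have u01 : 0 <= u <= 1 by rewrite (le_trans s0 (ltW su)) (le_trans (ltW us) s1).
    have [dg gu] := gP u (introT andP (conj su us)).
    split; first by rewrite -gu; exact: (is_deriveZ M^-1 (is_derive_Re_pairing b dg)).
    have := kobayashi_metric_half_space (velocity gamma u) Dc (Dg u u01).
    apply: le_trans; rewrite lee_fin gu normrM normfV (gtr0_norm M0) mulrC.
    rewrite ler_pM ?invr_ge0 ?(ltW M0)//; first by rewrite -ba Re_le_normc.
    have eu := ell_gt0 u01.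
    rewrite lef_pV2 ?posrE ?mulr_gt0 ?expR_gt0// ler_pM2l//.
    by have /andP[] := kobayashi_length_ell u01.
  - by rewrite lexx ler01.
by rewrite /h g0 g1 -mulrBr normrM normfV (gtr0_norm M0) ler_pdivrMl.
Qed.

Lemma kobayashi_length_pairing :
  normc (pairing a w - pairing a z) <= 2 * (C * (ell z * expR (C * L)) * L).
Proof.
rewrite (le_trans (normc_le _))// mulrDl mul1r lerD//.
  by rewrite raddfB; exact: kobayashi_length_Re.
have iaE x : pairing (- 'i *: a) x = - 'i * pairing a x.
  by rewrite /pairing mulr_sumr; apply: eq_bigr => j _; rewrite mxE mulrCA.
have ImE x : complex.Im (pairing a x) = complex.Re (pairing (- 'i *: a) x).
  by rewrite iaE; case: (pairing a x) => x1 x2 /=; ring.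
rewrite raddfB /= !ImE; apply: kobayashi_length_Re => v.
by rewrite iaE normcM /= !(oppr0, expr0n, add0r, sqrrN, expr1n, sqrtr1, mul1r).
Qed.

End functional.

(** The infimum need not be attained, but some curve has length below [L], and the bounds along it
    apply. *)
Lemma kobayashi_dist_estimate D a (z w : 'rV[R[i]]_N) (c L : R) :
  (forall x, D x -> complex.Re (pairing a x) < c) ->
  (kobayashi_dist D z w < L%:E)%E ->
  let M := (c - complex.Re (pairing a z)) * expR (4 * expR 1 * L) in
  [/\ (c - complex.Re (pairing a z)) * expR (- (4 * expR 1 * L))
        <= c - complex.Re (pairing a w),
      c - complex.Re (pairing a w) <= M &
      normc (pairing a w - pairing a z) <= 2 * (4 * expR 1 * M * L)].
Proof.
move=> Dc /ereal_inf_lt[_ [gamma zw <-] /ltW gL] M.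
have /andP[] := kobayashi_length_ell Dc zw gL (t := 1) (introT andP (conj ler01 (lexx _))).
have [_ _ _ ->] := zw; split=> //.
exact: kobayashi_length_pairing zw gL.
Qed.

End curves.

(** * The Kobayashi distance *)

Section segments.
Variables (R : realType) (N : nat).
Notation mu := (@lebesgue_measure R).
Implicit Types (D : set 'rV[R[i]]_N) (z w : 'rV[R[i]]_N).

Lemma cvg_complex (T : Type) (F : set_system T) (f : T -> R[i]) (l : R[i]) : Filter F ->
  complex.Re (f t) @[t --> F] --> complex.Re l ->
  complex.Im (f t) @[t --> F] --> complex.Im l -> f @ F --> l.
Proof.
move=> FF fre fim; apply: (@cvg_ballP _ _ T F FF f l).2 => _ /gt0_complex[e e0 ->].
have e20 : 0 < e / 2 by rewrite divr_gt0.
have h1 := (@cvg_ballP _ _ T F FF (fun t => complex.Re (f t)) _).1 fre _ e20.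
have h2 := (@cvg_ballP _ _ T F FF (fun t => complex.Im (f t)) _).1 fim _ e20.
apply: filterS2 h1 h2 => t; rewrite /ball /= => h1 h2.
rewrite ltc_norm (le_lt_trans (normc_le _))// !raddfB /= (splitr e) ltrD//.
Qed.

Definition segment_curve z w (t : R) : 'rV[R[i]]_N := z + t%:C *: (w - z).

Lemma segment_curve_derive z w (t : R) :
  curve_derivable (segment_curve z w) t /\ velocity (segment_curve z w) t = w - z.
Proof.
have affine (b m : R) : is_derive t 1 (fun t => b + t * m) m.
  have := is_deriveD (is_derive_cst b t 1) (is_deriveM (is_derive_id t 1) (is_derive_cst m t 1)).
  by rewrite scaler0 !add0r [_ *: 1]mulr1.
have dre j : is_derive t 1 (re_coord (segment_curve z w) j) (complex.Re ((w - z) ord0 j)).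
  rewrite (_ : re_coord _ _ = fun t => complex.Re (z ord0 j) + t * complex.Re ((w - z) ord0 j)).
    exact: affine.
  apply/funext => u; rewrite /re_coord /segment_curve !mxE.
  by case: (z ord0 j) (w ord0 j) => z1 z2 [w1 w2] /=; ring.
have dim j : is_derive t 1 (im_coord (segment_curve z w) j) (complex.Im ((w - z) ord0 j)).
  rewrite (_ : im_coord _ _ = fun t => complex.Im (z ord0 j) + t * complex.Im ((w - z) ord0 j)).
    exact: affine.
  apply/funext => u; rewrite /im_coord /segment_curve !mxE.
  by case: (z ord0 j) (w ord0 j) => z1 z2 [w1 w2] /=; ring.
split; first by move=> j; have [h1 _] := dre j; have [h2 _] := dim j; exact: (conj h1 h2).
apply/rowP => j; rewrite mxE !derive1E.
by have [_ ->] := dre j; have [_ ->] := dim j; case: ((w - z) ord0 j).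
Qed.

Lemma segment_curve_continuous z w : continuous (segment_curve z w).
Proof.
move=> t; have [dg _] := segment_curve_derive z w t.
apply: cvg_rV => j; have [dr di] := dg j; apply: cvg_complex.
  exact: (differentiable_continuous ((derivable1_diffP _ _).1 dr)).
exact: (differentiable_continuous ((derivable1_diffP _ _).1 di)).
Qed.

Lemma kobayashi_dist_le_segment D z w (M : R) : convex_domain D -> D z -> D w ->
  (forall t : R, 0 <= t <= 1 ->
    (kobayashi_metric D (segment_curve z w t) (w - z) <= M%:E)%E) ->
  (kobayashi_dist D z w <= M%:E)%E.
Proof.
move=> [_ cD] Dz Dw kM.
apply: (@le_trans _ _ (kobayashi_length D (segment_curve z w))).
  apply: ereal_inf_lbound; exists (segment_curve z w) => //; split.
  - split; first exact/continuous_subspaceT/segment_curve_continuous.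
    exists [:: 1]; first exact: itv_partition1.
    case=> // _; exists (fun=> w - z); first by apply: continuous_subspaceT => ?; exact: cvg_cst.
    by move=> t _; exact: segment_curve_derive.
  - move=> t t01; have := cD z w Dz Dw t t01; congr D.
    apply/rowP => j; rewrite /segment_curve !mxE.
    case: (z ord0 j) (w ord0 j) => z1 z2 [w1 w2].
    by apply/eqP; rewrite eq_complex /=; apply/andP; split; apply/eqP; ring.
  - by rewrite /segment_curve scale0r addr0.
  - by rewrite /segment_curve scale1r subrKC.
rewrite /kobayashi_length.
apply: (@le_trans _ _ (\int[mu]_(t in `[0%R, 1%R]) (cst M%:E) t)%E).
  apply: ge0_le_integral_nonmeasurable => t.
    by move=> _; exact: kobayashi_metric_ge0.
  rewrite /= in_itv /= => t01; have [_ ->] := segment_curve_derive z w t.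
  exact: kM.
rewrite integral_cst//; have := @lebesgue_measure_itv R `[0, 1].
by rewrite /= lte_fin ltr01 oppr0 adde0 => ->; rewrite mule1.
Qed.

Lemma kobayashi_dist_ge0 D z w : (0 <= kobayashi_dist D z w)%E.
Proof.
apply: le_ereal_inf_tmp => _ [g _ <-]; apply: integral_ge0 => t _.
exact: kobayashi_metric_ge0.
Qed.

Lemma kobayashi_dist_line D z w : convex_domain D ->
  (forall t : R[i], D (z + t *: (w - z))) -> kobayashi_dist D z w = 0%E.
Proof.
move=> cD zw; apply/eqP; rewrite eq_le kobayashi_dist_ge0 andbT.
apply: kobayashi_dist_le_segment => //.
- by have := zw 0; rewrite scale0r addr0.
- by have := zw 1; rewrite scale1r subrKC.
- move=> t _; rewrite kobayashi_metric_line// => s.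
  by rewrite /segment_curve -addrA -scalerDl.
Qed.

(** Every point of the segment is within [r / 2] of [w], hence is the centre of a polydisc of radius
    [r / 2] in [D]. *)
Lemma kobayashi_dist_le_polydisc D z w (r M : R) : convex_domain D -> D z ->
  0 < r -> 0 <= M -> M <= r / 2 ->
  (forall y : 'rV[R[i]]_N, (forall j, normc (y ord0 j - w ord0 j) < r) -> D y) ->
  (forall j, normc (z ord0 j - w ord0 j) <= M) ->
  (kobayashi_dist D z w <= (M / (r / 2))%:E)%E.
Proof.
move=> cD Dz r0 M0 Mr Dr zw.
have zw' j : normc (w ord0 j - z ord0 j) <= M by rewrite -normcN opprB.
apply: kobayashi_dist_le_segment => //.
  by apply: Dr => j; rewrite subrr normc0.
move=> t /andP[t0 t1]; apply: kobayashi_metric_le_polydisc => //.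
- by rewrite divr_gt0.
- move=> y yj; apply: Dr => j.
  rewrite (_ : _ - _ = (y ord0 j - segment_curve z w t ord0 j) +
      (1 - t)%:C * (z ord0 j - w ord0 j)); last first.
    rewrite /segment_curve !mxE; case: (z ord0 j) (w ord0 j) (y ord0 j) => a b [c d] [e f].
    by apply/eqP; rewrite eq_complex /=; apply/andP; split; apply/eqP; ring.
  rewrite (le_lt_trans (le_normcD _ _))// (splitr r) ltr_leD//.
  rewrite normcM /= expr0n addr0 sqrtr_sqr ger0_norm ?subr_ge0//.
  rewrite -[leRHS]mul1r ler_pM ?normc_ge0 ?subr_ge0 ?(le_trans (zw j))//.
  by rewrite gerBl.
- by move=> j; rewrite !mxE.
Qed.

End segments.

(** * Completeness *)

Section completeness.
Variable R : realType.

Lemma real_cauchy_cvg (x : nat -> R) :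
  (forall e, 0 < e -> exists n0, forall m n, (n0 <= m)%N -> (n0 <= n)%N -> `|x m - x n| < e) ->
  exists l : R, x n @[n --> \oo] --> l.
Proof.
move=> xc; apply/cvg_ex; apply: cauchy_cvg; apply: cauchy_exP => e e0.
have [n0 n0P] := xc e e0; exists (x n0); exists n0 => // n /= n0n.
by rewrite /ball /= n0P.
Qed.

Lemma complex_cauchy_cvg (x : nat -> R[i]) :
  (forall e, 0 < e -> exists n0, forall m n, (n0 <= m)%N -> (n0 <= n)%N ->
     normc (x m - x n) < e) ->
  exists l : R[i], x n @[n --> \oo] --> l.
Proof.
move=> xc.
have [|a xa] := @real_cauchy_cvg (fun n => complex.Re (x n)).
  move=> e /xc[n0 n0P]; exists n0 => m n h1 h2.
  by rewrite -raddfB (le_lt_trans (Re_le_normc _))// n0P.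
have [|b xb] := @real_cauchy_cvg (fun n => complex.Im (x n)).
  move=> e /xc[n0 n0P]; exists n0 => m n h1 h2.
  by rewrite -raddfB (le_lt_trans (Im_le_normc _))// n0P.
by exists (a +i* b); apply: cvg_complex.
Qed.

Lemma pairing_delta N (x : 'rV[R[i]]_N) j : pairing (delta_mx ord0 j) x = x ord0 j.
Proof.
rewrite /pairing (bigD1 j)//= mxE !eqxx mulr1 big1 ?addr0// => k kj.
by rewrite mxE (negPf kj) andbF mulr0.
Qed.

(** Makes the last bound of [kobayashi_dist_estimate] linear in [L], uniformly for base points with
    [l <= l']. *)
Lemma exp_bound_le (C l l' L : R) : 0 < C -> 0 < l -> l <= l' -> 0 < L -> L <= 1 ->
  2 * (C * (l * expR (C * L)) * L) <= 2 * (C * (l' * expR C)) * L.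
Proof.
move=> C0 l0 ll L0 L1; rewrite !mulrA ler_pM2r// -!mulrA !ler_pM2l//.
by rewrite ler_pM ?expR_ge0 ?(ltW l0)// ler_expR ler_piMr// ltW.
Qed.

Variables (N : nat) (D : set 'rV[R[i]]_N).
Hypothesis cD : convex_domain D.
Hypothesis bounded_coords : forall j, exists c : R, forall x, D x -> complex.Re (x ord0 j) < c.

Let coord_bound j : exists c : R, forall x, D x -> complex.Re (pairing (delta_mx ord0 j) x) < c.
Proof. by have [c cP] := bounded_coords j; exists c => x; rewrite pairing_delta; exact: cP. Qed.

Lemma coord_bounded_hyperbolic : hyperbolic D.
Proof.
move=> z w Dz Dw zw0; apply/rowP => j.
have [c cP] := coord_bound j.
set K : R := 2 * (4 * expR 1 * ((c - complex.Re (pairing (delta_mx ord0 j) z)) * expR (4 * expR 1))).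
have K0 : 0 < K.
  by rewrite !mulr_gt0 ?expR_gt0// subr_gt0 cP.
(* At distance 0 the estimate holds for every positive [L], and its right-hand side tends to 0 with
   [L]. *)
have le L : 0 < L -> L <= 1 -> normc (w ord0 j - z ord0 j) <= K * L.
  move=> L0 L1; have zwL : (kobayashi_dist D z w < L%:E)%E by rewrite zw0 lte_fin.
  have [_ _] := kobayashi_dist_estimate cP zwL.
  rewrite !pairing_delta => /le_trans; apply; rewrite -(pairing_delta z).
  by apply: exp_bound_le; rewrite ?subr_gt0 ?cP// mulr_gt0// expR_gt0.
suff : normc (w ord0 j - z ord0 j) <= 0.
  move=> n0; apply/esym/eqP; rewrite -subr_eq0; apply/eqP/eq0_normc/eqP.
  by rewrite eq_le n0 normc_ge0.
apply/ler_addgt0Pr => e e0; rewrite add0r.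
have L0 : 0 < Num.min 1 (e / K) by rewrite lt_min ltr01 divr_gt0.
rewrite (le_trans (le _ L0 _)) ?ge_min ?lexx//.
by rewrite mulrC -ler_pdivlMr// ge_min lexx orbT.
Qed.

Section cauchy.
Variable u : nat -> 'rV[R[i]]_N.
Hypothesis Du : forall n, D (u n).
Hypothesis cu : kobayashi_cauchy D u.

(** A tail lies within distance 1 of [u n0], so [kobayashi_dist_estimate] keeps it away from the
    hyperplane [Re a = c] and from infinity in the direction of [a]. *)
Lemma kobayashi_cauchy_bounds a (c : R) :
  (forall x, D x -> complex.Re (pairing a x) < c) ->
  exists d M : R, exists2 n0, 0 < d & forall n, (n0 <= n)%N ->
    d <= c - complex.Re (pairing a (u n)) <= M.
Proof.
move=> ac; have [n0 n0P] := cu ltr01.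
set l := c - complex.Re (pairing a (u n0)).
exists (l * expR (- (4 * expR 1 * 1))), (l * expR (4 * expR 1 * 1)), n0.
  by rewrite mulr_gt0 ?expR_gt0// subr_gt0 ac.
move=> n n0n; have [-> -> _] := kobayashi_dist_estimate ac (n0P n0 n (leqnn _) n0n).
by [].
Qed.

Lemma kobayashi_cauchy_coord j : exists l : R[i], u n ord0 j @[n --> \oo] --> l.
Proof.
have [c cP] := coord_bound j.
have [d [M [n0 d0 n0P]]] := kobayashi_cauchy_bounds cP.
set K : R := 2 * (4 * expR 1 * (M * expR (4 * expR 1))).
have M0 : 0 < M.
  by have /andP[h1 h2] := n0P n0 (leqnn _); rewrite (lt_le_trans d0)// (le_trans h1).
have K0 : 0 < K by rewrite !mulr_gt0 ?expR_gt0.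
apply: complex_cauchy_cvg => e e0.
(* [L <= 1] is the condition of [exp_bound_le]; the other bound gives [K * L <= e / 2]. *)
pose L : R := Num.min 1 (e / (2 * K)).
have L0 : 0 < L by rewrite /L lt_min ltr01 divr_gt0// mulr_gt0.
have L1 : L <= 1 by rewrite /L ge_min lexx.
have [n1 n1P] := cu L0.
exists (maxn n0 n1) => m n; rewrite !geq_max => /andP[n0m n1m] /andP[n0n n1n].
have [_ _] := kobayashi_dist_estimate cP (n1P n m n1n n1m).
rewrite !pairing_delta => /le_lt_trans; apply.
apply: (@le_lt_trans _ _ (K * L)).
  have /andP[h1 h2] := n0P n n0n; rewrite -(pairing_delta (u n)).
  by apply: exp_bound_le; rewrite ?subr_gt0 ?cP// mulr_gt0// expR_gt0.
apply: (@le_lt_trans _ _ (e / 2)).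
  rewrite mulrC -ler_pdivlMr// /L ge_min; apply/orP; right.
  by rewrite invfM mulrA.
by rewrite ltr_pdivrMr// ltr_pMr// ltr1n.
Qed.

(** If the coordinatewise limit [w] were outside [D], a functional [a] separating it with
    [c = Re (pairing a w)] would have [c - Re (pairing a (u n))] tend to 0, against the lower bound
    [d] of [kobayashi_cauchy_bounds]. *)
Lemma kobayashi_cauchy_limit :
  exists2 w, D w & u n @[n --> \oo] --> w.
Proof.
have [l lP] := choice kobayashi_cauchy_coord.
pose w : 'rV[R[i]]_N := \row_j l j.
have uw : u n @[n --> \oo] --> w by apply: cvg_rV => j; rewrite mxE; exact: lP.
exists w => //; apply: contrapT => Dw.
have [a aP] := convex_separation cD Dw.
have [d [M [n0 d0 n0P]]] := kobayashi_cauchy_bounds aP.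
have := @cvg_comp _ _ _ u (fun x => complex.Re (pairing a x)) _ _ _ uw
  (@continuous_Re_pairing R N a w).
move=> /cvgrPdist_lt /(_ d d0) [n1 _ n1P].
have := n1P (maxn n0 n1) (leq_maxr _ _).
rewrite ltNge => /negP; apply.
have /andP[h _] := n0P (maxn n0 n1) (leq_maxl _ _).
exact: le_trans h (ler_norm _).
Qed.

End cauchy.

(** The limit in [C^N] lies in [D], and inside a polydisc around it the Kobayashi distance to it is
    controlled by the coordinates, so convergence in [C^N] gives convergence in the Kobayashi
    distance. *)
Lemma coord_bounded_complete_hyperbolic : complete_hyperbolic D.
Proof.
split=> [|u Du cu]; first exact: coord_bounded_hyperbolic.
have [w Dw uw] := kobayashi_cauchy_limit Du cu.
exists w => //.
have [[oD _ _] _] := cD.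
have [r r0 rP] := open_polydisc oD Dw.
pose M n : R := \sum_j normc (u n ord0 j - w ord0 j).
have M0 n : 0 <= M n by apply: sumr_ge0 => j _; exact: normc_ge0.
have Mj n j : normc (u n ord0 j - w ord0 j) <= M n.
  by rewrite /M (bigD1 j)//= lerDl sumr_ge0// => k _; exact: normc_ge0.
have Mcvg : M n @[n --> \oo] --> (0 : R).
  rewrite (_ : 0 = \sum_(j < N) (0 : R)); last by rewrite big1.
  apply: (cvg_big (op := +%R)) => [|j _]; first exact: add_continuous.
  apply/cvgr0Pnorm_lt => e e0.
  have uj := @cvg_comp _ _ _ u (fun x : 'rV[R[i]]_N => x ord0 j) _ _ _ uw
    (@coord_continuous R[i] 1 N ord0 j w).
  have e0' : 0 < e%:C :> R[i] by rewrite ltcR.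
  have [n1 _ n1P] := (cvg_ballP _ _).1 uj _ e0'.
  exists n1 => // n /n1P; rewrite /ball /= ltc_norm => h.
  by rewrite ger0_norm ?normc_ge0// -normcN opprB.
apply: (@squeeze_cvge _ _ _ _ (cst 0%E) _ (fun n => (M n / (r / 2))%:E)).
- have r20 : 0 < r / 2 by rewrite divr_gt0.
  have [n1 _ n1P] := (cvgr0Pnorm_lt _).1 Mcvg _ r20; exists n1 => // n /n1P.
  rewrite ger0_norm// => Mn; rewrite kobayashi_dist_ge0/=.
  by apply: kobayashi_dist_le_polydisc => //; exact: ltW.
- exact: cvg_cst.
- apply/cvg_EFin; first by near=> n.
  rewrite (_ : 0 = 0 / (r / 2)); last by rewrite mul0r.
  by apply: cvgM => //; exact: cvg_cst.
Unshelve. all: by end_near. Qed.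

End completeness.

(** * Existence and uniqueness of the decomposition *)

Section existence.
Variables (R : realType) (N : nat) (D : set 'rV[R[i]]_N).
Hypothesis cD : convex_domain D.

Definition bounded_functional (a : 'rV[R[i]]_N) : Prop :=
  exists c : R, forall x, D x -> complex.Re (pairing a x) < c.

Lemma pairing_mulmx (a x : 'rV[R[i]]_N) : pairing a x = (x *m a^T) ord0 ord0.
Proof. by rewrite !mxE; apply: eq_bigr => j _; rewrite mxE. Qed.

Lemma pairing_row k (A : 'M[R[i]]_(k, N)) (x : 'rV[R[i]]_N) j :
  pairing (row j A) x = (x *m A^T) ord0 j.
Proof. by rewrite !mxE; apply: eq_bigr => l _; rewrite !mxE. Qed.

(** Independence limits the number of rows to [N]. When that number is maximal, a bounded functional
    outside the row space could still be stacked on [A], a contradiction. *)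
Lemma maximal_bounded_functionals :
  exists k (A : 'M[R[i]]_(k, N)), [/\ row_free A, forall i, bounded_functional (row i A) &
    forall a, bounded_functional a -> (a <= A)%MS].
Proof.
pose P k := `[< exists A : 'M[R[i]]_(k, N),
  row_free A /\ forall i, bounded_functional (row i A) >].
have P0 : exists k, P k.
  exists 0%N; apply/asboolP; exists 0; split; last by case.
  by rewrite -row_leq_rank.
have Pub k : P k -> (k <= N)%N.
  by move=> /asboolP[A [/eqP Afree _]]; move: (rank_leq_col A); rewrite Afree.
have [k /asboolP[A [Afree Ab]] kmax] := ex_maxnP P0 Pub.
exists k, A; split=> // a ab; apply: contraT => aA.
suff /kmax : P (1 + k)%N by rewrite add1n ltnn.
apply/asboolP; exists (col_mx a A); split.
  rewrite -row_leq_rank -addsmxE add1n.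
  have : (A < a + A)%MS.
    rewrite ltmxE addsmxSr /=; apply: contra aA => /(submx_trans (addsmxSl a A)).
    by [].
  by rewrite ltmxErank => /andP[_]; rewrite (eqP Afree).
move=> i; case: (split_ordP i) => j ->.
  by rewrite -[row _ _]/(row _ (col_mx a A)) rowKu (_ : row j a = a)//; apply/rowP => l;
    rewrite mxE ord1.
by rewrite rowKd.
Qed.

(** A functional strictly separating [y] from [D] is bounded on [D], hence a combination of the rows
    of [A]; it then takes the same value at [x] and at [y]. *)
Lemma bounded_saturated k (A : 'M[R[i]]_(k, N)) :
  (forall a, bounded_functional a -> (a <= A)%MS) ->
  forall x y, D x -> x *m A^T = y *m A^T -> D y.
Proof.
move=> Amax x y Dx xy; apply: contrapT => Dy.
have [a aP] := convex_separation cD Dy.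
have /submxP[C aE] : (a <= A)%MS by apply: Amax; exists (complex.Re (pairing a y)).
have := aP x Dx; rewrite !pairing_mulmx aE trmx_mul !mulmxA xy.
by rewrite ltxx.
Qed.

Lemma continuous_mulmxr m n (Q : 'M[R[i]]_(m, n)) : continuous (fun x : 'rV[R[i]]_m => x *m Q).
Proof.
move=> x; apply: (@cvg_rV _ _ (nbhs x) _ (mulmxr Q) (x *m Q) (nbhs_filter x)) => j.
rewrite (_ : (fun y => _) = pairing (row j Q^T)).
  by rewrite (_ : (x *m Q) ord0 j = pairing (row j Q^T) x);
    [exact: continuous_pairing|rewrite mxE; apply: eq_bigr => l _; rewrite !mxE].
by apply/funext => y; rewrite mxE; apply: eq_bigr => l _; rewrite !mxE.
Qed.

Lemma exists_hyperbolic_factor :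
  exists2 k : nat, (k <= N)%N & exists D' : set 'rV[R[i]]_k, hyperbolic_factor D D'.
Proof.
have [k [A [Afree Abnd Amax]]] := maximal_bounded_functionals.
have kN : (k <= N)%N by move: (rank_leq_col A); rewrite (eqP Afree).
have sat := bounded_saturated Amax.
exists k => //.
(* [B] spans a complement of the row space of [A]; the stacked matrix [M] is the change of
   coordinates. *)
have [B BA] : exists B : 'M[R[i]]_(N - k, N), (B :=: A^C)%MS.
  have <- : \rank A^C%MS = (N - k)%N by rewrite mxrank_compl (eqP Afree).
  by exists (row_base A^C%MS); exact: eq_row_base.
pose M := col_mx A B.
have Mfull : row_full M.
  rewrite /M /row_full -addsmxE (adds_eqmx (eqmx_refl A) BA).
  exact: addsmx_compl_full.
have Mfree : row_free M by rewrite /row_free (eqP Mfull) subnKC.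
(* [k + (N - k)] and [N] are equal but not convertible; being row free and row full, [M] has
   [pinvmx M] as a two-sided inverse. *)
have MV := mulmxVp Mfree; have VM := mulVpmx Mfull.
set V := pinvmx M in MV VM.
have VMT : V^T *m M^T = 1%:M by rewrite -trmx_mul MV trmx1.
have MVT : M^T *m V^T = 1%:M by rewrite -trmx_mul VM trmx1.
have MA n (x : 'M[R[i]]_(n, N)) : lsubmx (x *m M^T) = x *m A^T.
  by rewrite tr_col_mx mul_mx_row row_mxKl.
have [S SA] : exists S : 'M[R[i]]_(k, N), S *m A^T = 1%:M.
  by exists (row_mx 1%:M 0 *m V^T); rewrite -MA -mulmxA VMT mulmx1 row_mxKl.
(* As a preimage under the section [S], [D'] is open and convex. As the image of [D] in [D'E], which
   rests on saturation, it is connected and nonempty. *)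
pose D' : set 'rV[R[i]]_k := [set y | D (y *m S)].
have D'E : D' = (fun x => x *m A^T) @` D.
  apply/seteqP; split=> [y Dy|_ [x Dx <-]].
    by exists (y *m S) => //; rewrite -mulmxA SA mulmx1.
  by apply: sat Dx _; rewrite -!mulmxA SA mulmx1.
have [[oD conD [x0 Dx0]] convD] := cD.
have cD' : convex_domain D'.
  split; [split|].
  - by apply: open_comp oD => y _; exact: continuous_mulmxr.
  - rewrite D'E; apply: connected_continuous_connected => //.
    exact/continuous_subspaceT/continuous_mulmxr.
  - by rewrite D'E; exists (x0 *m A^T), x0.
  - move=> z0 z1 Dz0 Dz1 t t01; rewrite /D' /= mulmxDl -!scalemxAl.
    exact: convD.
pose f (x : 'rV[R[i]]_N) : 'rV[R[i]]_k * 'rV[R[i]]_(N - k) :=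
  (lsubmx (x *m M^T), rsubmx (x *m M^T)).
have flin : linear f.
  by move=> a x y; rewrite /f mulmxDl -scalemxAl !linearP.
pose fM := GRing.isLinear.Build _ _ _ _ f flin.
pose fL : {linear 'rV[R[i]]_N -> ('rV[R[i]]_k * 'rV[R[i]]_(N - k))%type} := HB.pack f fM.
pose g (p : 'rV[R[i]]_k * 'rV[R[i]]_(N - k)) := row_mx p.1 p.2 *m V^T.
have fK : cancel f g by move=> x; rewrite /f /g hsubmxK -mulmxA MVT mulmx1.
have gK : cancel g f.
  by move=> [y z]; rewrite /f /g -mulmxA VMT mulmx1 row_mxKl row_mxKr.
exists D'; split=> //.
  apply: coord_bounded_complete_hyperbolic => // j.
  have [c cP] := Abnd j; exists c => y Dy.
  by have := cP _ Dy; rewrite pairing_row -mulmxA SA mulmx1.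
exists fL; first by exists g.
apply/seteqP; split=> [_ [x Dx <-]|[y z] [/= Dy _]].
  by split=> //=; rewrite MA D'E; exists x.
(* [g (y, z)] and [y *m S] have the same image under [A^T], so saturation puts the whole fibre in
   [D]. *)
exists (g (y, z)); last exact: gK.
apply: sat Dy _.
by rewrite -mulmxA SA mulmx1 -MA -[lsubmx _]/(f _).1 gK.
Qed.

End existence.

(** * Uniqueness of the hyperbolic factor *)

Section uniqueness.
Variable R : realType.

Lemma hyperbolic_no_line k (D : set 'rV[R[i]]_k) (p v : 'rV[R[i]]_k) :
  convex_domain D -> hyperbolic D -> (forall t : R[i], D (p + t *: v)) -> v = 0.
Proof.
move=> cD hD pv.
have Dp : D p by have := pv 0; rewrite scale0r addr0.
have Dpv : D (p + v) by have := pv 1; rewrite scale1r.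
have /(hD _ _ Dp Dpv) /eqP : kobayashi_dist D p (p + v) = 0%E.
  by apply: kobayashi_dist_line => // t; rewrite addrAC subrr add0r.
by rewrite eq_sym -subr_eq0 addrAC subrr add0r => /eqP.
Qed.

Variables (N : nat) (D : set 'rV[R[i]]_N).
Hypothesis D0 : D !=set0.

(* The second factor of a splitting is the set of directions of the complex
   lines in [D], because a hyperbolic domain contains no complex line. *)
Lemma first_factor_determined k1 k2 (D1 : set 'rV[R[i]]_k1) (D2 : set 'rV[R[i]]_k2)
    (f1 : {linear 'rV[R[i]]_N -> ('rV[R[i]]_k1 * 'rV[R[i]]_(N - k1))%type})
    (f2 : {linear 'rV[R[i]]_N -> ('rV[R[i]]_k2 * 'rV[R[i]]_(N - k2))%type}) :
  injective f1 -> f1 @` D = D1 `*` setT -> f2 @` D = D2 `*` setT ->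
  convex_domain D2 -> hyperbolic D2 ->
  forall x y, (f1 x).1 = (f1 y).1 -> (f2 x).1 = (f2 y).1.
Proof.
move=> f1I f1D f2D cD2 hD2 x y xy.
have [x0 Dx0] := D0.
have f1d : (f1 (x - y)).1 = 0 by rewrite linearB /= xy subrr.
suff : (f2 (x - y)).1 = 0 by rewrite linearB /= => /eqP; rewrite subr_eq0 => /eqP.
apply: (@hyperbolic_no_line _ D2 (f2 x0).1) => // t.
(* Moving along [x - y] keeps the first [f1]-coordinate of [x0], which alone decides membership in
   [D]. *)
have Dt : D (x0 + t *: (x - y)).
  have : (f1 @` D) (f1 (x0 + t *: (x - y))).
    rewrite f1D; split=> //=; rewrite linearD linearZ /= f1d scaler0 addr0.
    by have : (f1 @` D) (f1 x0) by [exists x0]; rewrite f1D => -[].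
  by move=> [x1 Dx1 /f1I <-].
have : (f2 @` D) (f2 (x0 + t *: (x - y))) by exists (x0 + t *: (x - y)).
rewrite f2D => -[+ _].
have e u v : (f2 (u + t *: v)).1 = (f2 u).1 + t *: (f2 v).1.
  by rewrite linearD /= linearZ.
by rewrite /= e.
Qed.

Lemma hyperbolic_factor_unique k1 k2 (D1 : set 'rV[R[i]]_k1) (D2 : set 'rV[R[i]]_k2) :
  hyperbolic_factor D D1 -> hyperbolic_factor D D2 ->
  k1 = k2 /\ linearly_equivalent D1 D2.
Proof.
move=> [cD1 [hD1 _] [f1 [g1 f1K g1K] f1D]] [cD2 [hD2 _] [f2 [g2 f2K g2K] f2D]].
have d12 := first_factor_determined (can_inj f1K) f1D f2D cD2 hD2.
have d21 := first_factor_determined (can_inj f2K) f2D f1D cD1 hD1.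
(* By [d12] and [d21] the first coordinates under [f1] and [f2] determine each other. [T] is the
   induced map, computed on the lift with second coordinate 0; by [TE] every lift gives the same
   value. *)
pose T (y : 'rV[R[i]]_k1) := (f2 (g1 (y, 0))).1.
pose T' (y : 'rV[R[i]]_k2) := (f1 (g2 (y, 0))).1.
have TE x : T (f1 x).1 = (f2 x).1 by apply: d12; rewrite g1K.
have T'E x : T' (f2 x).1 = (f1 x).1 by apply: d21; rewrite g2K.
have sur1 y : exists x, y = (f1 x).1 by exists (g1 (y, 0)); rewrite g1K.
have sur2 y : exists x, y = (f2 x).1 by exists (g2 (y, 0)); rewrite g2K.
have Tlin : linear T.
  move=> a y z; have [x ->] := sur1 y; have [x' ->] := sur1 z.
  have := TE (a *: x + x'); rewrite linearP /= => ->.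
  by rewrite !TE linearP.
have T'lin : linear T'.
  move=> a y z; have [x ->] := sur2 y; have [x' ->] := sur2 z.
  have := T'E (a *: x + x'); rewrite linearP /= => ->.
  by rewrite !T'E linearP.
have TK : cancel T T' by move=> y; have [x ->] := sur1 y; rewrite TE T'E.
have T'K : cancel T' T by move=> y; have [x ->] := sur2 y; rewrite T'E TE.
pose TM := GRing.isLinear.Build _ _ _ _ T Tlin.
pose TL : {linear 'rV[R[i]]_k1 -> 'rV[R[i]]_k2} := HB.pack T TM.
pose T'M := GRing.isLinear.Build _ _ _ _ T' T'lin.
pose T'L : {linear 'rV[R[i]]_k2 -> 'rV[R[i]]_k1} := HB.pack T' T'M.
have dim_le m n (F : {linear 'rV[R[i]]_m -> 'rV[R[i]]_n})
    (G : {linear 'rV[R[i]]_n -> 'rV[R[i]]_m}) : cancel F G -> (m <= n)%N.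
  move=> FK; have /eqP <- : row_free (lin1_mx F).
    apply/row_freeP; exists (lin1_mx G); apply/row_matrixP => i.
    by rewrite row_mul rowE mul_rV_lin1 mul_rV_lin1 FK rowE mulmx1.
  exact: rank_leq_col.
split.
  apply/eqP; rewrite eqn_leq.
  by rewrite (dim_le _ _ TL T'L)// (dim_le _ _ T'L TL).
exists TL; first by exists T'.
apply/seteqP; split=> [_ [y Dy <-]|y Dy] /=.
  have : (f1 @` D) (y, 0) by rewrite f1D.
  move=> [x Dx xy]; have := TE x; rewrite xy /= => ->.
  by have : (f2 @` D) (f2 x) by [exists x]; rewrite f2D => -[].
have : (f2 @` D) (y, 0) by rewrite f2D.
move=> [x Dx xy]; exists (f1 x).1; last by rewrite TE xy.
by have : (f1 @` D) (f1 x) by [exists x]; rewrite f1D => -[].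
Qed.

End uniqueness.

Theorem proposition1p2 (R : realType) (N : nat) (D : set 'rV[R[i]]_N)
    (hD : convex_domain D) :
  (exists2 k : nat, (k <= N)%N &
     exists D' : set 'rV[R[i]]_k, hyperbolic_factor D D') /\
  (forall (k1 k2 : nat) (D1 : set 'rV[R[i]]_k1) (D2 : set 'rV[R[i]]_k2),
     (k1 <= N)%N -> (k2 <= N)%N ->
     hyperbolic_factor D D1 -> hyperbolic_factor D D2 ->
     k1 = k2 /\ linearly_equivalent D1 D2).
Proof.
split; first exact: exists_hyperbolic_factor.
move=> k1 k2 D1 D2 _ _; apply: hyperbolic_factor_unique.
by have [[]] := hD.
Qed.
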